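(* Let $2\le k\le n$, $f(y)=f_0(|y|)$ for $0<|y|<1$ ($y\in\mathbb R^n$), so that $(Q_+f)(x,\xi)=\Phi_+(t)$ is a function of $t=|2|x|-1|\in(0,1)$ only. Set $$H(v)=\frac{\pi^{1/2}}{\Gamma(k/2)}\left(\frac{1-v}{2}\right)^{k-2}\Phi_+(\sqrt v),\qquad 0<v<1.$$ If $$\int_\varepsilon^1 |f_0(s)|\,(1-s^2)^{(k-3)/2}\,s\,ds<\infty\quad\text{for every }\varepsilon\in(0,1),$$ then $f_0(s)$ can be reconstructed for almost all $s\in(0,1)$ by the formula $$f_0(s)=(1-s^2)^{(3-k)/2}\,(\mathcal D^{(k-1)/2}_{1-}H)(s^2).$$
   Context: For $x\in\mathbb R^n\setminus\{0\}$, $G^x_{n,k}$ is the set of all $k$-dimensional linear subspaces of $\mathbb R^n$ containing $x$; $\sigma_{k-1}=2\pi^{k/2}/\Gamma(k/2)$. For $0<|x|<1$, $\xi\in G^x_{n,k}$, $$(Q_+f)(x,\xi)=\frac{1}{\sigma_{k-1}}\int_{\mathbb S^{n-1}\cap\xi} f(x+(1-|x|)\theta)\,d\theta,$$ with $d\theta$ the surface area measure on $\mathbb S^{n-1}\cap\xi$. Right-sided Riemann–Liouville fractional integral and derivative on an interval with right endpoint $b$: for $\alpha>0$, $(I^\alpha_{b-}\varphi)(x)=\frac1{\Gamma(\alpha)}\int_x^b \varphi(y)(y-x)^{\alpha-1}dy$; writing $\alpha=m+\alpha_0$ with $m=[\alpha]$ the integer part and $0\le\alpha_0<1$, $(\mathcal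 D^\alpha_{b-}\varphi)(x)=(-d/dx)^{m+1}(I^{1-\alpha_0}_{b-}\varphi)(x)$. Here $b=1$. *)

(* Defs.v *)
From HB Require Import structures.
From mathcomp Require Import all_boot all_order all_algebra.
From mathcomp Require Import all_classical all_reals all_analysis.
From mathcomp Require Import measurable_realfun.

Set Implicit Arguments.
Unset Strict Implicit.
Unset Printing Implicit Defensive.

Import Order.TTheory GRing.Theory Num.Theory.
Import numFieldNormedType.Exports.

Local Open Scope classical_set_scope.
Local Open Scope ring_scope.

Section orthonormal_basis.
Context {R : realType} {n : nat}.
Implicit Types (u v : 'rV[R]_n) (e : seq 'rV[R]_n).

Definition dotv u v : R := \sum_(i < n) u 0 i * v 0 i.

(* The norm that the library puts on ['rV[R]_n] is the sup norm. *)
Definition enorm u : R := Num.sqrt (dotv u u).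

Definition orthonormal_seq e : Prop :=
  forall i j, (i < size e)%N -> (j < size e)%N -> dotv e`_i e`_j = (i == j)%:R.

Lemma dotvC u v : dotv u v = dotv v u.
Proof. by apply: eq_bigr => i _; rewrite mulrC. Qed.

Lemma dotvBl u1 u2 v : dotv (u1 - u2) v = dotv u1 v - dotv u2 v.
Proof.
by rewrite /dotv -sumrB; apply: eq_bigr => i _; rewrite !mxE mulrBl.
Qed.

Lemma dotvZl a u v : dotv (a *: u) v = a * dotv u v.
Proof.
by rewrite /dotv mulr_sumr; apply: eq_bigr => i _; rewrite !mxE mulrA.
Qed.

Lemma dotv_suml (I : finType) (F : I -> 'rV[R]_n) v :
  dotv (\sum_i F i) v = \sum_i dotv (F i) v.
Proof.
rewrite /dotv exchange_big /=; apply: eq_bigr => j _.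
by rewrite summxE mulr_suml.
Qed.

Lemma dotv_gt0 u : u != 0 -> 0 < dotv u u.
Proof.
move=> u0; rewrite lt_neqAle sumr_ge0 ?andbT; last first.
  by move=> i _; rewrite -expr2 sqr_ge0.
rewrite eq_sym; apply: contra u0; rewrite psumr_eq0; last first.
  by move=> i _; rewrite -expr2 sqr_ge0.
move=> /allP h; apply/eqP/rowP => i; rewrite mxE.
by have := h i (mem_index_enum _); rewrite -expr2 sqrf_eq0 => /eqP.
Qed.

Lemma gram_schmidt (s : seq 'rV[R]_n) : free s ->
  exists e, [/\ size e = size s, span e = span s & orthonormal_seq e].
Proof.
elim/last_ind: s => [|s v IH]; first by move=> _; exists [::].
rewrite -cats1 => frsv.
have frs : free s by exact: catl_free frsv.
have vs : v \notin span s.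
  move: frsv; rewrite (perm_free (permEl (perm_catC _ _))) /=.
  by rewrite free_cons => /andP[].
have [e [sz sp on]] := IH frs.
pose p := \sum_(i < size e) dotv v e`_i *: e`_i.
pose w := v - p.
have pin : p \in span e.
  by apply: memv_suml => i _; apply: memvZ; apply/memv_span/mem_nth.
have w0 : w != 0.
  by apply: contra vs; rewrite /w subr_eq0 => /eqP ->; rewrite -sp.
have wo j : (j < size e)%N -> dotv w e`_j = 0.
  move=> je; rewrite /w dotvBl dotv_suml (bigD1 (Ordinal je)) //= big1.
    by rewrite dotvZl on // eqxx mulr1 addr0 subrr.
  move=> i ij; rewrite dotvZl on //.
  by rewrite -val_eqE /= in ij; rewrite (negbTE ij) mulr0.
have wgt := dotv_gt0 w0.
have en0 : enorm w != 0 by rewrite /enorm sqrtr_eq0 -ltNge.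
pose x := (enorm w)^-1 *: w.
exists (rcons e x); split.
- by rewrite size_rcons sz size_cat addn1.
- rewrite -cats1 !span_cat !span_seq1 sp; apply/vspaceP => z.
  apply/memv_addP/memv_addP => -[a aS [_ /vlineP[c ->] ->]].
    exists (a - (c / enorm w) *: p).
      by rewrite memvB // memvZ // -sp.
    exists ((c / enorm w) *: v); first by rewrite memvZ // memv_line.
    by rewrite /x /w scalerA scalerBr addrAC addrA.
  exists (a + c *: p); first by rewrite memvD // memvZ // -sp.
  exists ((c * enorm w) *: x); first by rewrite memvZ // memv_line.
  by rewrite /x scalerA mulfK // /w -addrA -scalerDr (addrC p) subrK.
- have xe j : (j < size e)%N -> dotv x e`_j = 0.
    by move=> je; rewrite /x dotvZl wo // mulr0.
  have xx : dotv x x = 1.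
    rewrite /x dotvZl dotvC dotvZl mulrA -[dotv w w]sqr_sqrtr ?ltW //.
    by rewrite -/(enorm w) expr2 mulrACA mulVf // mulr1.
  move=> i j; rewrite size_rcons !ltnS => ie je; rewrite !nth_rcons.
  case: (ltngtP i (size e)) ie => // [ie _|ie _];
  case: (ltngtP j (size e)) je => // [je _|je _].
  + exact: on.
  + by rewrite dotvC xe // je ltn_eqF.
  + by rewrite xe // ie gtn_eqF.
  + by rewrite xx ie je eqxx.
Qed.

Lemma orthonormal_basis_exists (xi : {vspace 'rV[R]_n}) :
  exists e : (\dim xi).-tuple 'rV[R]_n, basis_of xi e /\ orthonormal_seq e.
Proof.
have [e [sz sp on]] := gram_schmidt (basis_free (vbasisP xi)).
have sze : size e == \dim xi by rewrite sz size_tuple.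
exists (Tuple sze); split => //=.
by rewrite basisEdim sp (span_basis (vbasisP xi)) subvv (eqP sze) leqnn.
Qed.

Definition orthonormal_basis (xi : {vspace 'rV[R]_n}) :
    (\dim xi).-tuple 'rV[R]_n :=
  sval (cid (orthonormal_basis_exists xi)).

End orthonormal_basis.

Section lebesgue_tuple.
Context {R : realType}.

Definition cons_tuple k (p : measurableTypeR R * k.-tuple (measurableTypeR R)) :
  k.+1.-tuple (measurableTypeR R) := [tuple of p.1 :: p.2].

Lemma measurable_cons_tuple k : measurable_fun setT (@cons_tuple k).
Proof. exact: measurable_cons. Qed.

Section step.
Context {k : nat}.
Variable mu : {sigma_finite_measure set (k.-tuple (measurableTypeR R)) -> \bar R}.

Definition lebesgue_cons : set (k.+1.-tuple (measurableTypeR R)) -> \bar R :=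
  pushforward (@lebesgue_measure R \x mu)%E (@cons_tuple k).

Let lebesgue_cons0 : lebesgue_cons set0 = 0%E.
Proof. by rewrite /lebesgue_cons /pushforward preimage_set0 measure0. Qed.

Let lebesgue_cons_ge0 A : (0 <= lebesgue_cons A)%E.
Proof. exact: (measure_ge0 (@lebesgue_measure R \x mu)%E). Qed.

Let lebesgue_cons_sigma_additive : semi_sigma_additive lebesgue_cons.
Proof.
move=> F mF tF mUF; rewrite /lebesgue_cons /pushforward preimage_bigcup.
apply: (@measure_semi_sigma_additive _ _ _ (@lebesgue_measure R \x mu)%E).
- by move=> i; rewrite -[X in measurable X]setTI; exact: measurable_cons_tuple.
- apply/trivIsetP => /= i j _ _ ij; rewrite -preimage_setI.
  by move/trivIsetP : tF => /(_ _ _ _ _ ij) ->//; rewrite preimage_set0.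
- rewrite -preimage_bigcup -[X in measurable X]setTI.
  exact: measurable_cons_tuple.
Qed.

HB.instance Definition _ := isMeasure.Build _ _ _ lebesgue_cons
  lebesgue_cons0 lebesgue_cons_ge0 lebesgue_cons_sigma_additive.

Let lebesgue_cons_sigma_finite : sigma_finite setT lebesgue_cons.
Proof.
have /sigma_finiteP[F [TF ndF Foo]] := sigma_finiteT (@lebesgue_measure R).
have /sigma_finiteP[G [TG ndG Goo]] := sigma_finiteT mu.
pose hd (t : k.+1.-tuple (measurableTypeR R)) := thead t.
pose tl (t : k.+1.-tuple (measurableTypeR R)) : k.-tuple (measurableTypeR R) :=
  [tuple of behead t].
exists (fun i => hd @^-1` F i `&` tl @^-1` G i).
  apply/seteqP; split => // t _.
  have [i _ Fi] : (\bigcup_i F i) (hd t) by rewrite -TF.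
  have [j _ Gj] : (\bigcup_i G i) (tl t) by rewrite -TG.
  exists (maxn i j) => //; split => /=.
    by move: Fi; exact/subsetPset/ndF/leq_maxl.
  by move: Gj; exact/subsetPset/ndG/leq_maxr.
move=> i; have [mF Fi] := Foo i; have [mG Gi] := Goo i; split.
  apply: measurableI; rewrite -[X in measurable X]setTI.
    exact: measurable_tnth.
  exact: measurable_behead.
rewrite /lebesgue_cons /pushforward (_ : _ @^-1` _ = F i `*` G i).
  by rewrite product_measure1E // lte_mul_pinfty // ge0_fin_numE.
have hK p : hd (cons_tuple p) = p.1 by [].
have tK p : tl (cons_tuple p) = p.2 by exact/val_inj.
by apply/seteqP; split => p; rewrite /preimage /= hK tK.
Qed.

HB.instance Definition _ := Measure_isSigmaFinite.Build _ _ _ lebesgue_cons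
  lebesgue_cons_sigma_finite.

End step.

Fixpoint lebesgue_tuple k :
    {sigma_finite_measure set (k.-tuple (measurableTypeR R)) -> \bar R} :=
  if k is k'.+1 then lebesgue_cons (lebesgue_tuple k')
  else \d_([tuple] : 0.-tuple (measurableTypeR R)).

End lebesgue_tuple.

Section sphere_measure.
Context {R : realType} (k : nat).
Implicit Types t : k.-tuple (measurableTypeR R).

Definition tnorm t : R := Num.sqrt (\sum_(i < k) tnth t i ^+ 2).

Definition unit_sphere : set (k.-tuple (measurableTypeR R)) :=
  [set t | tnorm t = 1].

Definition normalize t : k.-tuple (measurableTypeR R) :=
  [tuple tnth t i / tnorm t | i < k].

(* The surface measure is characterised by polar coordinates,
   [dy = r ^ (k - 1) dr dtheta]; applied to the cone over [A] this gives
   [|{y | 0 < |y| <= 1, y / |y| \in A}| = sigma(A) / k]. *)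
Definition sphere_measure (A : set (k.-tuple (measurableTypeR R))) : \bar R :=
  (k%:R%:E * lebesgue_tuple k
     [set y | (0 < tnorm y <= 1)%R /\ A (normalize y)])%E.

Lemma measurable_tnorm : measurable_fun setT tnorm.
Proof.
apply: (@measurableT_comp _ _ _ _ _ _ (@Num.sqrt R)).
  exact: continuous_measurable_fun (@sqrt_continuous R).
apply: measurable_sum => i; apply: measurable_funX; exact: measurable_tnth.
Qed.

Lemma measurable_normalize : measurable_fun setT normalize.
Proof.
apply/measurable_fun_tnthP => i.
rewrite (_ : _ \o _ = fun t => tnth t i * tnorm t `^ (-1)); last first.
  by apply/funext => t /=; rewrite tnth_mktuple powR_inv1 // sqrtr_ge0.
apply: measurable_funM; first exact: measurable_tnth.
exact: measurableT_comp (measurable_powR _) measurable_tnorm.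
Qed.

Let cone (A : set (k.-tuple (measurableTypeR R))) :
  set (k.-tuple (measurableTypeR R)) :=
  [set y | 0 < tnorm y <= 1 /\ A (normalize y)].

Let coneE A : cone A = tnorm @^-1` `]0, 1] `&` normalize @^-1` A.
Proof. by apply/seteqP; split => y /=; rewrite in_itv. Qed.

Let measurable_cone A : measurable A -> measurable (cone A).
Proof.
move=> mA; rewrite coneE; apply: measurableI.
- by rewrite -[X in measurable X]setTI; exact: measurable_tnorm.
- by rewrite -[X in measurable X]setTI; exact: measurable_normalize.
Qed.

Let sphere_measure0 : sphere_measure set0 = 0%E.
Proof.
rewrite /sphere_measure (_ : [set y | _] = set0) ?measure0 ?mule0 //.
by apply/seteqP; split => y // -[].
Qed.

Let sphere_measure_ge0 A : (0 <= sphere_measure A)%E.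
Proof. by rewrite mule_ge0 // lee_fin. Qed.

Let sphere_measure_sigma_additive : semi_sigma_additive sphere_measure.
Proof.
move=> F mF tF mUF.
have mF' i : measurable (cone (F i)) by exact: measurable_cone.
have tF' : trivIset setT (fun i => cone (F i)).
  apply/trivIsetP => i j _ _ ij; move/trivIsetP : tF => /(_ _ _ I I ij) F0.
  apply/seteqP; split => y // -[[_ Fi] [_ Fj]].
  by have : (F i `&` F j) (normalize y) by []; rewrite F0.
have UE : cone (\bigcup_i F i) = \bigcup_i cone (F i).
  apply/seteqP; split => y.
    by move=> [y1 [i _ Fi]]; exists i.
  by move=> [i _ [y1 Fi]]; split=> //; exists i.
rewrite [X in X @ _ --> _](_ : _ =
    (fun i => (k%:R%:E * \sum_(0 <= j < i) lebesgue_tuple k (cone (F j)))%E)).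
  rewrite /sphere_measure -/(cone _) UE; apply: cvgeZl => //.
  by apply: measure_semi_sigma_additive => //; exact: bigcup_measurable.
apply/funext => i; rewrite ge0_sume_distrr // => j _; exact: measure_ge0.
Qed.

HB.instance Definition _ := isMeasure.Build _ _ _ sphere_measure
  sphere_measure0 sphere_measure_ge0 sphere_measure_sigma_additive.

End sphere_measure.

Section Qplus.
Context {R : realType} {n : nat}.
Implicit Types (x : 'rV[R]_n) (xi : {vspace 'rV[R]_n}).

Definition Gamma (a : R) : R :=
  \int[lebesgue_measure]_(t in `]0, +oo[) (t `^ (a - 1) * expR (- t)).

(* [sphere_area k] is the area of the unit sphere of [R^k], written
   sigma_{k-1} in terms of the dimension of the sphere. *)
Definition sphere_area (k : nat) : R :=
  2 * pi `^ (k%:R / 2) / Gamma (k%:R / 2).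

Definition of_coord xi (c : (\dim xi).-tuple R) : 'rV[R]_n :=
  \sum_(i < \dim xi) tnth c i *: (orthonormal_basis xi)`_i.

(* Integral over the unit sphere of [xi], in orthonormal coordinates of [xi]. *)
Definition sphere_integral xi (g : 'rV[R]_n -> R) : R :=
  \int[@sphere_measure R (\dim xi)]_(c in @unit_sphere R (\dim xi))
    g (of_coord c).

Definition Qplus (f : 'rV[R]_n -> R) x xi : R :=
  (sphere_area (\dim xi))^-1 *
  sphere_integral xi (fun theta => f (x + (1 - enorm x) *: theta)).

Definition grass_through (k : nat) x : set {vspace 'rV[R]_n} :=
  [set xi | \dim xi = k /\ x \in xi].

End Qplus.

Section RiemannLiouville.
Context {R : realType}.
Implicit Types (a b x : R) (phi h : R -> R).

Definition RLint b a phi x : R :=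
  (Gamma a)^-1 *
  \int[lebesgue_measure]_(y in `]x, b[) (phi y * (y - x) `^ (a - 1)).

Definition RLint_cvg b a phi x : Prop :=
  (@lebesgue_measure R).-integrable `]x, b[
    (fun y => (phi y * (y - x) `^ (a - 1))%:E).

Definition RLderiv b a phi : R -> R :=
  let m := Num.truncn a in
  iter m.+1 (fun h x => - derive1 h x) (RLint b (1 - (a - m%:R)) phi).

(* The [j]-th derivative of [h] exists at [x]. *)
Fixpoint derivable_n (j : nat) h x : Prop :=
  if j is j'.+1 then
    (\forall y \near x, derivable_n j' h y) /\ derivable (derive1n j' h) x 1
  else True.

(* [RLderiv] is total, so its existence has to be asserted separately. *)
Definition RLderivable b a phi x : Prop :=
  let m := Num.truncn a in
  (\forall y \near x, RLint_cvg b (1 - (a - m%:R)) phi y) /\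
  derivable_n m.+1 (RLint b (1 - (a - m%:R)) phi) x.

End RiemannLiouville.

Definition radial_on_ball (R : realType) (n : nat)
    (f : 'rV[R]_n -> R) (f0 : R -> R) : Prop :=
  forall y, 0 < enorm y < 1 -> f y = f0 (enorm y).

Definition Qplus_profile (R : realType) (n k : nat)
    (f : 'rV[R]_n -> R) (Phi : R -> R) : Prop :=
  forall x xi, 0 < enorm x < 1 -> grass_through k x xi ->
    0 < `|2 * enorm x - 1| -> Qplus f x xi = Phi `|2 * enorm x - 1|.

Definition Hplus (R : realType) (k : nat) (Phi : R -> R) (v : R) : R :=
  Num.sqrt pi / Gamma (k%:R / 2) * ((1 - v) / 2) ^+ (k - 2) *
  Phi (Num.sqrt v).

(* Main.v *)
Require Import Defs.
From HB Require Import structures.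
From mathcomp Require Import all_boot all_order all_algebra.
From mathcomp Require Import all_classical all_reals all_analysis.
From mathcomp Require Import measurable_realfun gauss_integral ring lra.

Set Implicit Arguments.
Unset Strict Implicit.
Unset Printing Implicit Defensive.

Import Order.TTheory GRing.Theory Num.Theory.
Import numFieldNormedType.Exports.

Local Open Scope classical_set_scope.
Local Open Scope ring_scope.

(** For a radial [f] the integral over the unit sphere of [xi] depends only on
    the height [c] of the point over the direction of [x], and in [R^k] the
    height has density proportional to [(1 - c^2)^((k-3)/2)].  Substituting
    [u = |x + (1 - |x|) theta|^2], which is affine in [c] and runs over
    [(t^2, 1)], turns [H] into the Riemann-Liouville integral of order
    [(k-1)/2] of [F u = f_0 (sqrt u) (1 - u)^((k-3)/2)].  By the semigroup law
    the further integral of order [1 - alpha_0] is the [m+1]-fold primitive of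
    [F], so that [m] derivatives are classical and the last one is given almost
    everywhere by Lebesgue's differentiation theorem. *)

(** * Densities and substitutions *)

(** Two obstacles shape the proof. The hypothesis controls [f0] only for the completed Lebesgue
    measure and only on each []e, 1[], while product measures and images of measures call for Borel
    functions. So [f0] is replaced by a Borel [g0] off a null set [N] of radii; as the height has a
    density, the points of a sphere whose radius falls in [N] form a null set, for every [x] and
    [xi]. Secondly, the sphere integral may diverge for some [t], where [Phi] is nevertheless
    prescribed. The identification of [H] with a fractional integral is therefore proved at every
    point, both sides carrying the same infinite value before [fine] is applied; after the further
    integration the order is [m + 1 >= 1], the kernel is bounded and convergence holds at every [v].
    The law of the height is found without angular coordinates: squaring maps Lebesgue measure to
    [sqrt pi] times the kernel of order 1/2, so the semigroup law gives the squared norm of [k]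
    coordinates the kernel of order [k / 2], and rotations are reduced to those of a plane. *)

Section nonnegative_integrals.
Local Open Scope ereal_scope.

Import HBNNSimple.

(** Both sides agree on indicators by [nuE], hence on simple functions, and monotone convergence
    does the rest. Densities can thus be verified on sets, where uniqueness of measures is
    available. *)
Lemma ge0_integral_density d (T : measurableType d) (R : realType)
    (mu nu : {measure set T -> \bar R}) (h : T -> R) (f : T -> \bar R) :
  measurable_fun setT h -> (forall x, 0 <= h x)%R ->
  (forall A, measurable A -> nu A = \int[mu]_(x in A) (h x)%:E) ->
  measurable_fun setT f -> (forall x, 0 <= f x) ->
  \int[nu]_x f x = \int[mu]_x (f x * (h x)%:E).
Proof.
move=> mh h0 nuE mf f0; pose f_ := nnsfun_approx measurableT mf.
have f_cvg x : (f_ n x)%:E @[n --> \oo] --> f x.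
  by apply: cvg_nnsfun_approx.
transitivity (limn (fun n => \int[nu]_x (f_ n x)%:E)).
  rewrite -monotone_convergence//.
  - by apply: eq_integral => x _; apply/esym/cvg_lim => //; exact: f_cvg.
  - by move=> n; exact/measurable_EFinP.
  - by move=> n x _; rewrite lee_fin.
  - by move=> x _ m n mn; rewrite lee_fin; exact/lefP/nd_nnsfun_approx.
rewrite (_ : (fun n => _) = (fun n => \int[mu]_x ((f_ n x)%:E * (h x)%:E))).
  rewrite -monotone_convergence//.
  - apply: eq_integral => x _; apply/cvg_lim => //.
    by apply: cvgeZr => //; exact: f_cvg.
  - move=> n; apply: emeasurable_funM => //; exact/measurable_EFinP.
  - by move=> n x _; rewrite mule_ge0 ?lee_fin.
  - move=> x _ m n mn; apply: lee_wpmul2r; rewrite lee_fin //.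
    exact/lefP/nd_nnsfun_approx.
apply/funext => n.
under eq_integral do rewrite fimfunE -fsumEFin//.
rewrite ge0_integral_fsum//; last 2 first.
  - by move=> r; exact/measurable_EFinP/measurableT_comp.
  - by move=> r x _; rewrite nnfun_muleindic_ge0.
transitivity (\sum_(r \in range (f_ n))
    \int[mu]_x ((r * \1_(f_ n @^-1` [set r]) x)%:E * (h x)%:E)).
  apply: eq_fsbigr => r; rewrite inE => -[z _ <-{r}].
  set A := f_ n @^-1` _.
  have mA : measurable A by rewrite -[A]setTI; exact: measurable_funP.
  under eq_integral do rewrite EFinM.
  under [RHS]eq_integral do rewrite EFinM -muleA.
  have mA1 : measurable_fun setT (fun x => (\1_A x : R)%:E).
    by apply/measurable_EFinP; exact: measurable_indic.
  rewrite !ge0_integralZl ?lee_fin //; last 2 first.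
  - by apply: emeasurable_funM => //; exact/measurable_EFinP.
  - by move=> x _; rewrite mule_ge0 ?lee_fin.
  rewrite integral_indic // setIT nuE // integral_mkcond; congr (_ * _).
  by apply: eq_integral => x _; rewrite epatch_indic muleC.
rewrite -ge0_integral_fsum//; last 2 first.
  - move=> s; apply: emeasurable_funM; last exact/measurable_EFinP.
    apply/measurable_EFinP.
    exact: measurableT_comp.
  - by move=> s x _; rewrite mule_ge0 ?nnfun_muleindic_ge0 ?lee_fin.
apply: eq_integral => x _; rewrite [in RHS]fimfunE -fsumEFin//.
rewrite ge0_mule_fsuml //.
by move=> r; rewrite nnfun_muleindic_ge0.
Qed.

End nonnegative_integrals.

(** The truncated power [x_+^a]. Since [powR] does not vanish on negative numbers, the cut is made
    here; domains of integration then sit in the integrand, and convolutions and substitutions run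
    over the whole line. *)
Definition pospow (R : realType) (a x : R) : R := if 0 < x then x `^ a else 0.

Section pospow.
Context {R : realType}.
Implicit Types a x : R.
Local Notation mu := (@lebesgue_measure R).

Lemma pospow_ge0 a x : 0 <= pospow a x.
Proof. by rewrite /pospow; case: ifP => // _; exact: powR_ge0. Qed.

Lemma measurable_pospow a : measurable_fun setT (pospow a).
Proof.
apply: measurable_fun_ifT => //; exact: measurable_fun_ltr.
Qed.

Lemma pospowD a b x : pospow (a + b) x = pospow a x * pospow b x.
Proof.
rewrite /pospow; case: ifP => x0; last by rewrite mulr0.
by rewrite powRD // (gt_eqF x0) implybT.
Qed.

Lemma pospowM a x y : 0 < x -> pospow a (x * y) = x `^ a * pospow a y.
Proof.
move=> x0; rewrite /pospow pmulr_rgt0 //; case: ifP => y0;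
  last by rewrite mulr0.
by rewrite powRM // ltW.
Qed.

Lemma continuous_powR a x : 0 < x -> {for x, continuous (@powR R ^~ a)}.
Proof.
move=> x0; apply/differentiable_continuous/derivable1_diffP/derivable_powR.
by rewrite in_itv /= x0.
Qed.

(** For [a < 1] the integrand is unbounded at 0, so the fundamental theorem is applied on
    [[b / (n + 2), b]] and the intervals exhaust []0, b]]; [a > 0] makes the lower boundary term
    vanish. *)
Lemma integral_powR a b : 0 < a -> 0 <= b ->
  (\int[mu]_(x in `]0%R, b]) (x `^ (a - 1))%:E = (b `^ a / a)%:E)%E.
Proof.
move=> a0; rewrite le_eqVlt => /predU1P[<-|b0].
  by rewrite set_itvoc0 integral_set0 powR0 ?gt_eqF // mul0r.
pose e n : R := b / n.+2%:R.
have e0 n : 0 < e n by rewrite divr_gt0.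
have eb n : e n < b by rewrite ltr_pdivrMr // ltr_pMr // ltr1n.
have e_cvg : e n @[n --> \oo] --> 0.
  rewrite -[X in _ --> X](mulr0 b); apply: cvgMr.
  by have := @cvg_harmonic R; rewrite -cvg_shiftS.
have Un : `]0, b]%classic = \bigcup_n `[e n, b]%classic.
  apply/seteqP; split => x /=; rewrite !in_itv /=.
    move=> /andP[x0 xb].
    have [N _ NP] := cvgr_lt _ e_cvg _ x0.
    exists N => //=; rewrite in_itv /= xb andbT; apply: ltW;
      exact: (NP N (leqnn N)).
  by move=> [n _] /=; rewrite in_itv /= => /andP[ex ->];
    rewrite (lt_le_trans _ ex).
have F2 n : (\int[mu]_(x in `[e n, b]) (x `^ (a - 1))%:E =
    (b `^ a / a)%:E - (e n `^ a / a)%:E)%E.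
  have ctn x : 0 < x -> {for x, continuous (fun x : R => x `^ a / a)}.
    by move=> x0; apply: cvgMl; exact: continuous_powR.
  apply: (@continuous_FTC2 _ _ (fun x => x `^ a / a)) => //.
  - apply: continuous_in_subspaceT => x; rewrite inE /= in_itv /= => /andP[ex
      _].
    exact/continuous_powR/(lt_le_trans _ ex).
  - split.
    + move=> x; rewrite in_itv /= => /andP[ex _].
      apply: derivableM => //; apply: derivable_powR.
      by rewrite in_itv /= (lt_trans _ ex).
    + exact/cvg_at_right_filter/ctn.
    + exact/cvg_at_left_filter/ctn.
  - move=> x; rewrite in_itv /= => /andP[ex _].
    have x0 : x \in `]0, +oo[ by rewrite in_itv /= (lt_trans _ ex).
    rewrite derive1E deriveM //; last exact: derivable_powR.
    rewrite derive_cst scaler0 add0r -derive1E powR_derive1 //.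
    by rewrite /GRing.scale /= mulrA mulVf ?gt_eqF // mul1r.
rewrite Un.
have := @ge0_nondecreasing_set_cvg_integral _ (measurableTypeR R) R
  (fun n => `[e n, b]%classic) (fun x => (x `^ (a - 1))%:E) mu.
move=> /(_ _ _ _ _)/cvg_lim => <- //; first last.
- by move=> n x _; rewrite lee_fin powR_ge0.
- by move=> n; apply/measurable_funTS/measurable_EFinP; exact: measurable_powR.
- move=> m n mn; apply/subsetPset => x /=; rewrite !in_itv /=.
  move=> /andP[ex ->]; rewrite andbT (le_trans _ ex) //.
  by rewrite /e ler_pM2l // lef_pV2 ?posrE // ler_nat.
apply/cvg_lim => //.
under eq_fun do rewrite F2 -EFinB.
apply: cvg_EFin; first by near=> n.
rewrite -[X in _ --> X]subr0; apply: cvgB; first exact: cvg_cst.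
rewrite -[X in _ --> X](mul0r a^-1); apply: cvgMl.
have := powR_cvg0 a0; move/cvg_at_rightP => /(_ e); apply.
by split => //.
Unshelve. all: end_near. Qed.

End pospow.

Section substitution.
Context {R : realType}.
Local Notation mu := (@lebesgue_measure R).
Local Open Scope ereal_scope.

Let image (phi : measurableTypeR R -> measurableTypeR R)
    (mphi : measurable_fun setT phi) :
    {measure set (measurableTypeR R) -> \bar R} :=
  measure_function_pushforward__canonical__measure_function_Measure mu mphi.

(** By uniqueness of Lebesgue measure: [|a|] times its image under the affine map gives half-open
    intervals their length. A negative [a] swaps the closed end, which costs no measure. *)
Lemma ge0_integral_affine (a b : R) (f : R -> \bar R) : a != 0%R ->
  measurable_fun setT f -> (forall x, 0 <= f x) ->
  \int[mu]_x f x = `|a|%:E * \int[mu]_x f (a * x + b)%R.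
Proof.
move=> a0 mf f0.
have mphi : measurable_fun setT (fun x : R => a * x + b : R)%R.
  by apply: measurable_funD => //; exact: measurable_funM.
have a1 : (0 <= `|a|)%R by [].
transitivity (\int[mscale (NngNum a1) (image mphi)]_x f x).
  apply: eq_measure_integral => A mA _; apply: lebesgue_measure_unique => //.
  move=> _ [[p q]] _ <-.
  rewrite lebesgue_measure_itv /= lte_fin /mscale /= /pushforward.
  have [a_gt0|a_lt0|a_eq0] := ltgtP a 0%R; last by rewrite a_eq0 eqxx in a0.
  - rewrite (_ : _ @^-1` _ = `[(q - b) / a, (p - b) / a[%classic)%R.
      rewrite lebesgue_measure_itv /= lte_fin ltr_nM2r ?invr_lt0 // ltrD2r.
      case: ifPn => pq; last by rewrite mule0.
      rewrite -!EFinD -EFinM; congr EFin; rewrite ltr0_norm //; field.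
      by rewrite a0.
    apply/seteqP; split => x /=; rewrite !in_itv /= ler_ndivrMr // ltr_ndivlMr
      //.
      by rewrite ltrBlDr lerBrDr mulrC => /andP[-> ->].
    by rewrite ltrBlDr lerBrDr mulrC => /andP[-> ->].
  - rewrite (_ : _ @^-1` _ = `](p - b) / a, (q - b) / a]%classic)%R.
      rewrite lebesgue_measure_itv /= lte_fin ltr_pM2r ?invr_gt0 // ltrD2r.
      case: ifPn => pq; last by rewrite mule0.
      rewrite -!EFinD -EFinM; congr EFin; rewrite gtr0_norm //; field.
      by rewrite a0.
    apply/seteqP; split => x /=; rewrite !in_itv /= ltr_pdivrMr // ler_pdivlMr
      //.
      by rewrite ltrBlDr lerBrDr mulrC => /andP[-> ->].
    by rewrite ltrBlDr lerBrDr mulrC => /andP[-> ->].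
by rewrite ge0_integral_mscale //= ge0_integral_pushforward.
Qed.

(** The proofs [mh] and [h0] are arguments so that the measure structure, which rests on them, is
    inferred from the term. *)
Let density (h : R -> R) (mh : measurable_fun setT h) (h0 : forall x, (0 <= h
  x)%R)
    (A : set (measurableTypeR R)) : \bar R :=
  \int[mu]_(x in A) (h x)%:E.

Section dens.
Variables (h : R -> R) (mh : measurable_fun setT h) (h0 : forall x, (0 <= h
  x)%R).
Local Notation dens := (@density h mh h0).

Let dens0 : dens set0 = 0. Proof. exact: integral_set0. Qed.

Let dens_ge0 A : 0 <= dens A.
Proof. by apply: integral_ge0 => x _; rewrite lee_fin. Qed.

Let dens_sigma_additive : semi_sigma_additive dens.
Proof.
apply: semi_sigma_additive_nng_induced; last by move=> x; rewrite lee_fin.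
exact/measurable_EFinP.
Qed.

HB.instance Definition _ := isMeasure.Build _ _ _ dens
  dens0 dens_ge0 dens_sigma_additive.
End dens.

(** The image of Lebesgue measure under squaring has density [s^(-1/2)]: both measures give []-oo,
    q[] the mass [2 sqrt q] for [q > 0] and 0 otherwise, and these half-lines determine them. The
    two roots of [s] account for the missing 1/2. *)
Lemma ge0_integral_sqr (f : R -> \bar R) :
  measurable_fun setT f -> (forall x, 0 <= f x) ->
  \int[mu]_x f (x ^+ 2)%R = \int[mu]_x (f x * (pospow (- 2^-1) x)%:E).
Proof.
move=> mf f0.
have mphi : measurable_fun setT (fun x : R => x ^+ 2 : R)%R.
  exact: exprn_measurable.
have mh : measurable_fun setT (@pospow R (- 2^-1)) by exact: measurable_pospow.
have h0 x : (0 <= @pospow R (- 2^-1) x)%R by exact: pospow_ge0.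
transitivity (\int[image mphi]_x f x).
  by rewrite ge0_integral_pushforward.
apply: ge0_integral_density => // A mA.
pose dm : {measure set (measurableTypeR R) -> \bar R} := @density _ mh h0.
rewrite -[RHS]/(dm A).
have sqrE q : image mphi `]-oo, q[%classic =
    if (0 < q)%R then (2 * Num.sqrt q)%:E else 0.
  rewrite /= /pushforward; case: ltP => q0.
    rewrite (_ : _ @^-1` _ = `](- Num.sqrt q)%R, Num.sqrt q[%classic).
      rewrite lebesgue_measure_itv /= lte_fin gtrN ?sqrtr_gt0 // -EFinD.
      by rewrite opprK mulr2n mulrDl mul1r.
    apply/seteqP; split => x /=; rewrite !in_itv /= -ltr_norml.
      by rewrite -(ltr_sqrt _ q0) sqrtr_sqr.
    by rewrite -(ltr_sqrt _ q0) sqrtr_sqr.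
  rewrite (_ : _ @^-1` _ = set0) ?measure0 //.
  apply/seteqP; split => x //=; rewrite in_itv /=.
  by move=> /lt_le_trans/(_ q0); rewrite ltNge sqr_ge0.
have dmE q : dm `]-oo, q[%classic = if (0 < q)%R then (2 * Num.sqrt q)%:E else
  0.
  rewrite /= /density; case: ltP => q0; last first.
    apply: integral0_eq => x /=; rewrite in_itv /= /pospow => xq.
    by rewrite ltNge (le_trans (ltW xq)).
  rewrite integral_itv_bndo_bndc; last first.
    exact/measurable_funTS/measurable_EFinP.
  transitivity (\int[mu]_(x in `]0%R, q]) (x `^ (2^-1 - 1))%:E).
    rewrite integral_mkcond [RHS]integral_mkcond; apply: eq_integral => x _.
    rewrite !patchE !mem_setE !in_itv /= /pospow.
    case: (ltP 0%R x) => x0 /=; last by rewrite if_same.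
    by rewrite (_ : - 2^-1 = 2^-1 - 1)%R //; field.
  rewrite integral_powR ?invr_gt0 ?(ltW q0) // powR12_sqrt ?(ltW q0) //.
  by rewrite invrK mulrC.
apply: (@measure_unique _ R (measurableTypeR R) (@RGenInftyO.G R)
  (fun n => `]-oo, n%:R[%classic) _ _ _ _ (image mphi) dm) => //.
- exact: RGenInftyO.measurableE.
- move=> _ _ [x ->] [y ->]; exists (Num.min x y).
  by apply/seteqP; split => z /=; rewrite !in_itv /= lt_min => /andP.
- by move=> i; exists i%:R.
- apply/seteqP; split => // x _.
  have [n xn] : exists n, (x < n%:R)%R.
    by exists (Num.bound `|x|); exact: le_lt_trans (ler_norm x) (archi_boundP
      (normr_ge0 x)).
  by exists n => //=; rewrite in_itv.
- by move=> _ [q ->]; rewrite sqrE dmE.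
- move=> n; rewrite sqrE; case: ifPn => // _; exact: ltry.
Qed.

End substitution.

(** * Gamma function and the kernels of fractional integration *)

Section gamma_beta.
Context {R : realType}.
Implicit Types a b x y : R.
Local Notation mu := (@lebesgue_measure R).
Local Open Scope ereal_scope.

Lemma lebesgue_tonelli (f : R -> R -> \bar R) :
  measurable_fun setT (fun p : measurableTypeR R * measurableTypeR R => f p.1
    p.2) ->
  (forall x y, 0 <= f x y) ->
  \int[mu]_x \int[mu]_y f x y = \int[mu]_y \int[mu]_x f x y.
Proof.
move=> mf f0.
by apply: (fubini_tonelli (fun p : measurableTypeR R * measurableTypeR R => f
  p.1 p.2)).
Qed.

Lemma measurable_fun_integral2 (f : R -> R -> \bar R) :
  measurable_fun setT (fun p : measurableTypeR R * measurableTypeR R => f p.1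
    p.2) ->
  (forall x y, 0 <= f x y) ->
  measurable_fun setT (fun x => \int[mu]_y f x y).
Proof.
move=> mf f0.
exact: (measurable_fun_fubini_tonelli_F
  (fun p : measurableTypeR R * measurableTypeR R => f p.1 p.2)).
Qed.

Lemma ge0_integral_subr x (f : R -> \bar R) :
  measurable_fun setT f -> (forall y, 0 <= f y) ->
  \int[mu]_y f (y - x)%R = \int[mu]_y f y.
Proof.
move=> mf f0.
rewrite [RHS](ge0_integral_affine (- x) (oner_neq0 R)) // normr1 mul1e.
by apply: eq_integral => y _; rewrite mul1r.
Qed.

(** Extended real values let the Tonelli identities for Gamma and Beta be stated before finiteness
    is known; finiteness is then deduced from them. *)
Definition gammae a : \bar R := \int[mu]_t (pospow (a - 1) t * expR (- t))%:E.

Definition betae a b : \bar R :=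
  \int[mu]_s (pospow (a - 1) s * pospow (b - 1) (1 - s))%:E.

Lemma gammae_ge0 a : 0 <= gammae a.
Proof. by apply: integral_ge0 => t _; rewrite lee_fin mulr_ge0 ?pospow_ge0. Qed.

Lemma betae_ge0 a b : 0 <= betae a b.
Proof. by apply: integral_ge0 => t _; rewrite lee_fin mulr_ge0 ?pospow_ge0. Qed.

(** Homogeneity: substitute [y = x s]. For [x <= 0] the two truncated powers have disjoint
    supports. *)
Lemma pospow_conv a b x :
  \int[mu]_y (pospow (a - 1) y * pospow (b - 1) (x - y))%:E =
  (pospow (a + b - 1) x)%:E * betae a b.
Proof.
have mf c : measurable_fun setT (fun y : R => (pospow (a - 1) y * pospow (b - 1)
  (c - y))%:E).
  apply/measurable_EFinP/measurable_funM; first exact: measurable_pospow.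
  apply: measurableT_comp; first exact: measurable_pospow.
  exact: measurable_funB.
have f0 c y : 0 <= (pospow (a - 1) y * pospow (b - 1) (c - y))%:E :> \bar R.
  by rewrite lee_fin mulr_ge0 ?pospow_ge0.
have [x0|x0] := ltP 0%R x; last first.
  rewrite {3}/pospow ltNge x0 mul0e integral0_eq // => y _; rewrite /pospow.
  have [y0|y0] := ltP 0%R y; last by rewrite mul0r.
  by rewrite subr_gt0 ltNge (le_trans x0 (ltW y0)) mulr0.
rewrite (ge0_integral_affine 0%R (lt0r_neq0 x0) (mf x) (f0 x)) (gtr0_norm x0).
under eq_integral => s _.
  rewrite addr0 -[X in (X - x * s)%R]mulr1 -mulrBr !pospowM // mulrACA EFinM.
  over.
rewrite ge0_integralZl; last 4 first.
- by [].
- exact: mf.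
- by move=> y _; exact: f0.
- by rewrite lee_fin mulr_ge0 ?powR_ge0.
rewrite muleA -EFinM; congr (_%:E * _).
rewrite /pospow x0 -[X in (X * _)%R](powRr1 (ltW x0)) -!powRD ?(gt_eqF x0)
  ?implybT //.
by congr (_ `^ _)%R; ring.
Qed.

(* Both sides are the integral of [t^(a-1) s^(b-1) exp(-t-s)] over the
   quadrant, the right-hand one in the variables [t] and [t + s]. *)
Lemma gammae_mul a b : gammae a * gammae b = betae a b * gammae (a + b).
Proof.
pose F t u : \bar R := (pospow (a - 1) t * pospow (b - 1) (u - t) * expR (-
  u))%:E.
have F0 t u : 0 <= F t u.
  by rewrite lee_fin !mulr_ge0 ?pospow_ge0 ?expR_ge0.
have mE c : measurable_fun setT (fun t : R => (pospow (c - 1) t * expR (-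
  t))%:E).
  apply/measurable_EFinP/measurable_funM; first exact: measurable_pospow.
  by apply: measurableT_comp => //; exact: measurable_funN.
have mF : measurable_fun setT
    (fun p : measurableTypeR R * measurableTypeR R => F p.1 p.2).
  apply/measurable_EFinP; apply: measurable_funM; first apply: measurable_funM.
  - exact: measurableT_comp (measurable_pospow _) measurable_fst.
  - apply: measurableT_comp (measurable_pospow _) _.
    exact: measurable_funB.
  - by apply: measurableT_comp => //; exact: measurableT_comp.
have E0 c t : 0 <= (pospow (c - 1) t * expR (- t))%:E :> \bar R.
  by rewrite lee_fin mulr_ge0 ?pospow_ge0.
transitivity (\int[mu]_t \int[mu]_u F t u).
  rewrite /gammae -ge0_integralZr; last 4 first.
  - by [].
  - exact: mE.
  - by move=> t _; exact: E0.
  - exact: gammae_ge0.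
  apply: eq_integral => t _.
  rewrite -[X in _ * X](ge0_integral_subr t (mE b) (E0 b)).
  rewrite -ge0_integralZl; last 4 first.
  - by [].
  - apply/measurable_EFinP/measurable_funM.
      apply: measurableT_comp (measurable_pospow _) _; exact: measurable_funB.
    apply: measurableT_comp => //; apply: measurable_funN;
      exact: measurable_funB.
  - by move=> u _; exact: E0.
  - exact: E0.
  apply: eq_integral => u _; rewrite /F -EFinM; congr EFin.
  by rewrite mulrACA -expRD; congr (_ * expR _)%R; ring.
rewrite (lebesgue_tonelli mF F0).
transitivity (\int[mu]_u (betae a b * (pospow (a + b - 1) u * expR (- u))%:E)).
  apply: eq_integral => u _.
  under eq_integral do rewrite /F EFinM muleC.
  rewrite ge0_integralZl; last 4 first.
  - by [].
  - apply/measurable_EFinP/measurable_funM; first exact: measurable_pospow.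
    apply: measurableT_comp (measurable_pospow _) _; exact: measurable_funB.
  - by move=> t _; rewrite lee_fin mulr_ge0 ?pospow_ge0.
  - by rewrite lee_fin expR_ge0.
  by rewrite pospow_conv muleA -EFinM mulrC muleC.
rewrite ge0_integralZl; last 4 first.
- by [].
- exact: mE.
- by move=> t _; exact: E0.
- exact: betae_ge0.
by [].
Qed.

Lemma gammae1 : gammae 1 = 1.
Proof.
have mexp : measurable_fun setT (fun t : R => (expR (- t))%:E).
  by apply/measurable_EFinP; apply: measurableT_comp => //;
    exact: measurable_funN.
transitivity (\int[mu]_(t in `]0%R, +oo[) (expR (- t))%:E).
  rewrite [RHS]integral_mkcond; apply: eq_integral => t _.
  rewrite patchE mem_setE in_itv /= andbT subrr /pospow.
  by case: ifP => _; rewrite ?mul0r // powRr0 mul1r.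
rewrite integral_itv_obnd_cbnd; last exact: measurable_funTS.
rewrite -[RHS](@integral_exponential_pdf R 1 ltr01) integral_mkcond.
apply: eq_integral => t _; rewrite /exponential_pdf !patchE.
by case: ifP => // _; rewrite mul1r mulN1r.
Qed.

Lemma betae1 a : (0 < a)%R -> betae a 1 = (a^-1)%:E.
Proof.
move=> a0; rewrite /betae subrr.
transitivity (\int[mu]_(x in `]0%R, 1%R]) (x `^ (a - 1))%:E).
  rewrite -integral_itv_bndo_bndc; last first.
    by apply/measurable_funTS/measurable_EFinP; exact: measurable_powR.
  rewrite [RHS]integral_mkcond; apply: eq_integral => x _.
  rewrite patchE mem_setE in_itv /= /pospow subr_gt0.
  case: (0 < x)%R; last by rewrite mul0r.
  by case: (x < 1)%R; rewrite /= ?mulr0 // powRr0 mulr1.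
by rewrite integral_powR // powR1 div1r.
Qed.

(** The product formula replaces integration by parts: with second argument 1 the Beta factor is
    [1 / (n + 1) > 0], so an infinite value at [n + 2] would force one at [n + 1]. *)
Lemma gammae_nat_lty n : gammae n.+1%:R < +oo.
Proof.
elim: n => [|n IH]; first by rewrite gammae1 ltry.
have := gammae_mul n.+1%:R 1.
rewrite gammae1 mule1 (betae1 (ltr0Sn R n)) natr1 => h; move: IH; rewrite h.
have := gammae_ge0 n.+2%:R; case: (gammae _) => [r _ _|_|//]; first exact: ltry.
by rewrite gt0_muley ?lte_fin ?invr_gt0.
Qed.

(** On []0, 1]] drop the exponential; beyond 1 raise the exponent to an integer above [a]. *)
Lemma gammae_lty a : (0 < a)%R -> gammae a < +oo.
Proof.
move=> a0; pose n := Num.bound a.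
have an : (a < n.+1%:R)%R.
  by rewrite (lt_trans (archi_boundP (ltW a0))) // ltr_nat.
have m1 : measurable_fun setT ((fun x : R => (x `^ (a - 1))%:E) \_ `]0%R, 1%R]).
  apply/(measurable_restrictT _ _).1 => //;
    apply/measurable_funTS/measurable_EFinP.
  exact: measurable_powR.
have mE c : measurable_fun setT (fun t : R => (pospow (c - 1) t * expR (-
  t))%:E).
  apply/measurable_EFinP/measurable_funM; first exact: measurable_pospow.
  by apply: measurableT_comp => //; exact: measurable_funN.
have p1 x : 0 <= ((fun x : R => (x `^ (a - 1))%:E) \_ `]0%R, 1%R]) x.
  by rewrite patchE; case: ifP; rewrite ?lee_fin ?powR_ge0.
have E0 c t : 0 <= (pospow (c - 1) t * expR (- t))%:E :> \bar R.
  by rewrite lee_fin mulr_ge0 ?pospow_ge0.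
apply: (@le_lt_trans _ _ (\int[mu]_x (((fun x : R => (x `^ (a - 1))%:E) \_
  `]0%R, 1%R]) x +
    (pospow (n.+1%:R - 1) x * expR (- x))%:E))).
  apply: ge0_le_integral => //.
  - exact: mE.
  - by apply: emeasurable_funD => //; exact: mE.
  move=> x _; rewrite patchE mem_setE in_itv /= {1}/pospow.
  have [x0|x0] := ltP 0%R x; last by rewrite mul0r adde_ge0 //.
  have [x1|x1] := leP x 1%R => /=.
    apply: le_trans (leeDl _ (E0 _ _)); rewrite lee_fin ger_pMr ?powR_gt0 //.
    by rewrite -expR0 ler_expR oppr_le0 ltW.
  rewrite add0e lee_fin ler_pM2r ?expR_gt0 // /pospow x0 ler_powR ?ltW //.
  by rewrite ltrD2r.
rewrite ge0_integralD //; last exact: mE.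
rewrite -integral_mkcond integral_powR // lte_add_pinfty ?ltry //.
exact: gammae_nat_lty.
Qed.

Lemma gammae_gt0 a : (0 < a)%R -> 0 < gammae a.
Proof.
move=> a0; apply: (@lt_le_trans _ _ (\int[mu]_(x in `]0%R, 1%R]) ((expR (-
  1))%:E * (x `^ (a - 1))%:E))).
  rewrite ge0_integralZl; last 4 first.
  - by [].
  - by apply/measurable_funTS/measurable_EFinP; exact: measurable_powR.
  - by move=> x _; rewrite lee_fin powR_ge0.
  - by rewrite lee_fin expR_ge0.
  by rewrite integral_powR // -EFinM lte_fin mulr_gt0 ?expR_gt0 // powR1 div1r
    invr_gt0.
rewrite integral_mkcond; apply: ge0_le_integral => //.
- by move=> x _; rewrite patchE; case: ifP => // _;
    rewrite lee_fin mulr_ge0 ?expR_ge0 ?powR_ge0.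
- apply/(measurable_restrictT _ _).1 => //; apply/measurable_funTS.
  apply: emeasurable_funM; first exact: measurable_cst.
  by apply/measurable_EFinP; exact: measurable_powR.
- apply/measurable_EFinP/measurable_funM; first exact: measurable_pospow.
  by apply: measurableT_comp => //; exact: measurable_funN.
move=> x _; rewrite patchE mem_setE in_itv /= /pospow.
have [x0|x0] /= := ltP 0%R x; last by rewrite mul0r.
have [x1|x1] := leP x 1%R; last by rewrite lee_fin mulr_ge0 ?powR_ge0.
by rewrite -EFinM lee_fin mulrC ler_wpM2l ?powR_ge0 // ler_expR lerN2.
Qed.

Lemma EFin_Gamma a : (0 < a)%R -> (Gamma a)%:E = gammae a.
Proof.
move=> a0; rewrite /Gamma /Rintegral.
rewrite (_ : integral _ _ _ = gammae a); last first.
  rewrite integral_mkcond; apply: eq_integral => t _.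
  rewrite patchE mem_setE in_itv /= andbT /pospow.
  by case: ifP => // _; rewrite mul0r.
by rewrite fineK // ge0_fin_numE ?gammae_ge0 // gammae_lty.
Qed.

Lemma Gamma_gt0 a : (0 < a)%R -> (0 < Gamma a)%R.
Proof. by move=> a0; rewrite -lte_fin EFin_Gamma // gammae_gt0. Qed.

(** The substitution [t = x^2] in the Gaussian integral over the line. *)
Lemma Gamma_half : Gamma 2^-1 = Num.sqrt pi :> R.
Proof.
apply: EFin_inj; rewrite EFin_Gamma ?invr_gt0 // -integralT_gauss.
transitivity (\int[mu]_x ((expR (- x))%:E * (pospow (- 2^-1) x)%:E)).
  apply: eq_integral => x _; rewrite -EFinM mulrC.
  by congr ((expR _ * pospow _ _)%:E); field.
rewrite -(@ge0_integral_sqr _ (fun x => (expR (- x))%:E)) //.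
by apply/measurable_EFinP; apply: measurableT_comp => //;
  exact: measurable_funN.
Qed.

(* The kernel of the Riemann-Liouville integral of order [a]. *)
Definition rlker a x : R := (Gamma a)^-1 * pospow (a - 1) x.

Lemma rlker_ge0 a x : (0 < a)%R -> (0 <= rlker a x)%R.
Proof. by move=> a0; rewrite mulr_ge0 ?pospow_ge0 // invr_ge0 ltW ?Gamma_gt0.
  Qed.

Lemma measurable_rlker a : measurable_fun setT (rlker a).
Proof. by apply: measurable_funM => //; exact: measurable_pospow. Qed.

Lemma rlker_conv a b x : (0 < a)%R -> (0 < b)%R ->
  \int[mu]_y (rlker a y * rlker b (x - y))%:E = (rlker (a + b) x)%:E.
Proof.
move=> a0 b0; have ab0 : (0 < a + b)%R by rewrite addr_gt0.
under eq_integral do rewrite /rlker mulrACA EFinM.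
rewrite ge0_integralZl; last 4 first.
- by [].
- apply/measurable_EFinP/measurable_funM; first exact: measurable_pospow.
  apply: measurableT_comp (measurable_pospow _) _; exact: measurable_funB.
- by move=> y _; rewrite lee_fin mulr_ge0 ?pospow_ge0.
- by rewrite lee_fin mulr_ge0 // invr_ge0 ltW ?Gamma_gt0.
rewrite pospow_conv.
have := gammae_mul a b; rewrite -!EFin_Gamma // /rlker.
(* Beta is finite here: times [Gamma (a + b) > 0] it equals the finite product
   [Gamma a * Gamma b]. *)
move: (betae_ge0 a b) (Gamma_gt0 a0) (Gamma_gt0 b0) (Gamma_gt0 ab0).
move: (betae a b) (Gamma a) (Gamma b) (Gamma (a + b)) => [B||] ga gb gab //;
  last first.
  by move=> _ ga0 gb0 gab0; rewrite gt0_mulye ?lte_fin.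
move=> _ ga0 gb0 gab0 [GB]; rewrite -EFinM; congr EFin.
rewrite mulrCA [RHS]mulrC; congr (_ * _)%R.
have -> : B = (ga * gb / gab)%R by rewrite GB mulfK ?gt_eqF.
by field; rewrite !gt_eqF.
Qed.

End gamma_beta.

(** * Integration over the sphere *)

Section rotation_plane.
Context {R : realType}.
Local Notation mu := (@lebesgue_measure R).
Local Open Scope ereal_scope.

Lemma measurable_fun_comp2 d (T : measurableType d) (K : R -> R -> \bar R)
    (u v : T -> R) :
  measurable_fun setT
    (fun p : measurableTypeR R * measurableTypeR R => K p.1 p.2) ->
  measurable_fun setT u -> measurable_fun setT v ->
  measurable_fun setT (fun x => K (u x) (v x)).
Proof.
move=> mK mu_ mv.
exact: (measurableT_comp mK (measurable_fun_pair mu_ mv)).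
Qed.

(* Two affine substitutions: [p = c x + s y] in [y], for which
   [x^2 + y^2 = p^2 + ((x - c p) / s)^2], then [q = (x - c p) / s] in [x]. *)
Lemma ge0_integral_rotation (K : R -> R -> \bar R) (c s : R) :
  measurable_fun setT
    (fun p : measurableTypeR R * measurableTypeR R => K p.1 p.2) ->
  (forall x y, 0 <= K x y) -> (c ^+ 2 + s ^+ 2 = 1)%R -> s != 0%R ->
  \int[mu]_x \int[mu]_y K (c * x + s * y)%R (x ^+ 2 + y ^+ 2)%R =
  \int[mu]_x \int[mu]_y K x (x ^+ 2 + y ^+ 2)%R.
Proof.
move=> mK K0 cs s0.
have s2 : (s ^+ 2 = 1 - c ^+ 2)%R by rewrite -cs addrC addKr.
pose L p x : \bar R := K p (p ^+ 2 + ((x - c * p) / s) ^+ 2)%R.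
have mL : measurable_fun setT
    (fun p : measurableTypeR R * measurableTypeR R => L p.1 p.2).
  apply: measurable_fun_comp2 mK _ _ => //.
  apply: measurable_funD; apply: measurable_funX => //.
  apply: measurable_funM => //; apply: measurable_funB => //.
  exact: measurable_funM.
have mL' : measurable_fun setT
    (fun p : measurableTypeR R * measurableTypeR R => L p.2 p.1).
  exact: (measurableT_comp mL (measurable_fun_pair measurable_snd
    measurable_fst)).
have L0 p x : 0 <= L p x by exact: K0.
have mL1 x : measurable_fun setT (L^~ x).
  exact: (measurableT_comp mL (measurable_fun_pair (@measurable_id _ _ _)
    (@measurable_cst _ _ _ _ _ x))).
have mL2 p : measurable_fun setT (L p).
  exact: (measurableT_comp mL (measurable_fun_pair (@measurable_cst _ _ _ _ _ p)
    (@measurable_id _ _ _))).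
transitivity (\int[mu]_x ((`|s|^-1)%:E * \int[mu]_p L p x)).
  apply: eq_integral => x _.
  rewrite (ge0_integral_affine (c * x)%R s0 (mL1 x)) //.
  rewrite muleA -EFinM mulVf ?normr_eq0 // mul1e.
  apply: eq_integral => y _; rewrite /L (addrC (s * y)%R); congr (K _ _).
  have -> : ((x - c * (c * x + s * y)) / s = s * x - c * y)%R.
    by apply: (mulIf s0); rewrite divfK // mulrBl mulrAC -expr2 s2; ring.
  by rewrite -[LHS]mul1r -cs; ring.
rewrite ge0_integralZl; last 4 first.
- by [].
- exact: (measurable_fun_integral2 mL').
- by move=> x _; exact: integral_ge0.
- by rewrite lee_fin.
rewrite (lebesgue_tonelli (f := fun x p => L p x) mL' (fun x p => L0 p x)).
rewrite -ge0_integralZl; last 4 first.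
- by [].
- exact: (measurable_fun_integral2 mL).
- by move=> x _; exact: integral_ge0.
- by rewrite lee_fin.
apply: eq_integral => p _.
have sV0 : (s^-1 != 0)%R by rewrite invr_eq0.
rewrite -normfV (_ : \int[mu]_y K p (p ^+ 2 + y ^+ 2)%R =
  `|s^-1|%:E * \int[mu]_x K p (p ^+ 2 + (s^-1 * x + - (c * p / s)) ^+ 2)%R) //.
  congr (_ * _); apply: eq_integral => x _; rewrite /L mulrBl (mulrC x).
  by [].
apply: (@ge0_integral_affine R s^-1 _ (fun y => K p (p ^+ 2 + y ^+ 2)%R)) => //.
apply: measurable_fun_comp2 mK _ _ => //.
by apply: measurable_funD => //; exact: measurable_funX.
Qed.

End rotation_plane.

Section tuple_integrals.
Context {R : realType}.
Local Notation mu := (@lebesgue_measure R).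
Local Notation T k := (k.-tuple (measurableTypeR R)).
Local Open Scope ereal_scope.

Definition sqnorm k (t : T k) : R := (\sum_(i < k) tnth t i ^+ 2)%R.

Definition tdot k (e t : T k) : R := (\sum_(i < k) tnth e i * tnth t i)%R.

Lemma measurable_sqnorm k : measurable_fun setT (@sqnorm k).
Proof.
by apply: measurable_sum => i; apply: measurable_funX; exact: measurable_tnth.
Qed.

Lemma measurable_tdot k (e : T k) : measurable_fun setT (tdot e).
Proof.
apply: measurable_sum => i; apply: measurable_funM => //.
exact: measurable_tnth.
Qed.

Lemma sqnorm_ge0 k (t : T k) : (0 <= sqnorm t)%R.
Proof. by apply: sumr_ge0 => i _; exact: sqr_ge0. Qed.

Lemma sqnorm0 (t : T 0) : sqnorm t = 0%R.
Proof. by rewrite /sqnorm big_ord0. Qed.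

Lemma sqnorm_cons k x (t : T k) :
  sqnorm (Defs.cons_tuple (x, t)) = (x ^+ 2 + sqnorm t)%R.
Proof.
rewrite /sqnorm big_ord_recl /=; congr (_ + _)%R.
by apply: eq_bigr => i _; rewrite tnthS.
Qed.

Lemma tdot_cons k e (es : T k) x (t : T k) :
  tdot (Defs.cons_tuple (e, es)) (Defs.cons_tuple (x, t)) = (e * x + tdot es
    t)%R.
Proof.
rewrite /tdot big_ord_recl /=; congr (_ + _)%R.
by apply: eq_bigr => i _; rewrite !tnthS.
Qed.

Lemma cons_tupleK k (t : T k.+1) :
  Defs.cons_tuple (thead t, [tuple of behead t]) = t.
Proof. by rewrite [RHS]tuple_eta; exact: val_inj. Qed.

Lemma integral_lebesgue_tuple0 (G : T 0 -> \bar R) :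
  measurable_fun setT G ->
  \int[lebesgue_tuple 0]_t G t = G [tuple].
Proof. by move=> mG; rewrite /= integral_dirac // diracT mul1e. Qed.

Lemma ge0_integral_lebesgue_tupleS k (G : T k.+1 -> \bar R) :
  measurable_fun setT G -> (forall t, 0 <= G t) ->
  \int[lebesgue_tuple k.+1]_t G t =
  \int[mu]_x \int[lebesgue_tuple k]_t G (Defs.cons_tuple (x, t)).
Proof.
move=> mG G0.
rewrite [LHS](_ : _ = \int[pushforward (mu \x lebesgue_tuple k)
  (@Defs.cons_tuple R k)]_t G t) //.
rewrite (ge0_integral_pushforward (@measurable_cons_tuple R k)) //.
rewrite fubini_tonelli1 //.
by apply: measurableT_comp => //; exact: measurable_cons_tuple.
by move=> p; exact: G0.
Qed.

End tuple_integrals.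

Section sqnorm_integral.
Context {R : realType}.
Local Notation mu := (@lebesgue_measure R).
Local Notation T k := (k.-tuple (measurableTypeR R)).
Local Open Scope ereal_scope.

(** Normalised by [Gamma 2^-1 = sqrt pi], the density of a squared coordinate is the fractional
    kernel of order 1/2, so sums of squares obey the semigroup law. *)
Lemma ge0_integral_sqr_rlker (g : R -> \bar R) :
  measurable_fun setT g -> (forall x, 0 <= g x) ->
  \int[mu]_x g (x ^+ 2)%R =
  (Num.sqrt pi)%:E * \int[mu]_s (g s * (rlker 2^-1 s)%:E).
Proof.
move=> mg g0; rewrite (ge0_integral_sqr mg g0).
rewrite -ge0_integralZl; last 4 first.
- by [].
- by apply: emeasurable_funM => //; apply/measurable_EFinP;
    exact: measurable_rlker.
- by move=> s _; rewrite mule_ge0 // lee_fin rlker_ge0 // invr_gt0.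
- by rewrite lee_fin sqrtr_ge0.
apply: eq_integral => s _; rewrite muleCA -EFinM; congr (_ * _%:E).
rewrite /rlker Gamma_half mulrA divff ?gt_eqF ?sqrtr_gt0 ?pi_gt0 // mul1r.
by congr (pospow _ _); field.
Qed.

(** One more coordinate convolves the law of the squared norm with the kernel of order 1/2 and so
    raises its order by 1/2. *)
Lemma ge0_integral_sqr_conv (g : R -> \bar R) a :
  measurable_fun setT g -> (forall x, 0 <= g x) -> (0 < a)%R ->
  \int[mu]_x \int[mu]_s (g (x ^+ 2 + s)%R * (rlker a s)%:E) =
  (Num.sqrt pi)%:E * \int[mu]_w (g w * (rlker (a + 2^-1) w)%:E).
Proof.
move=> mg g0 a0.
have h0 : (0 < 2^-1 :> R)%R by rewrite invr_gt0.
have r0 b x : (0 < b)%R -> 0 <= (rlker b x)%:E :> \bar R.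
  by move=> b0; rewrite lee_fin rlker_ge0.
have mr b : measurable_fun setT (fun x : R => (rlker b x)%:E).
  by apply/measurable_EFinP; exact: measurable_rlker.
have mr2 d (S : measurableType d) b (u : S -> R) : measurable_fun setT u ->
    measurable_fun setT (fun x => (rlker b (u x))%:E).
  by move=> mu_; exact: measurableT_comp (mr b) mu_.
have mg2 d (S : measurableType d) (u : S -> R) : measurable_fun setT u ->
    measurable_fun setT (fun x => g (u x)).
  by move=> mu_; exact: measurableT_comp mg mu_.
pose F x s := g (x ^+ 2 + s)%R * (rlker a s)%:E.
have mF : measurable_fun setT
    (fun p : measurableTypeR R * measurableTypeR R => F p.1 p.2).
  apply: emeasurable_funM; last exact: mr2.
  apply: mg2; apply: measurable_funD => //; exact: measurable_funX.
have F0 x s : 0 <= F x s by rewrite mule_ge0 ?r0.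
pose G w s := g w * (rlker a s * rlker 2^-1 (w - s))%:E.
have mG : measurable_fun setT
    (fun p : measurableTypeR R * measurableTypeR R => G p.1 p.2).
  apply: emeasurable_funM; first exact: mg2.
  under eq_fun do rewrite EFinM.
  apply: emeasurable_funM; first exact: mr2.
  apply: mr2; exact: measurable_funB.
have G0 w s : 0 <= G w s by rewrite mule_ge0 // EFinM mule_ge0 ?r0.
have mG' : measurable_fun setT
    (fun p : measurableTypeR R * measurableTypeR R => G p.2 p.1).
  exact: (measurableT_comp mG (measurable_fun_pair measurable_snd
    measurable_fst)).
rewrite (lebesgue_tonelli mF F0).
transitivity (\int[mu]_s ((Num.sqrt pi)%:E * \int[mu]_w G w s)).
  apply: eq_integral => s _; rewrite /F.
  have mgs : measurable_fun setT (fun x : R => g (x + s)%R).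
    by apply: mg2; exact: measurable_funD.
  rewrite ge0_integralZr; last 4 first.
  - by [].
  - apply: mg2; apply: measurable_funD => //; exact: measurable_funX.
  - by move=> x _; exact: g0.
  - exact: r0.
  rewrite (ge0_integral_sqr_rlker mgs); last by move=> x; exact: g0.
  rewrite -muleA; congr (_ * _).
  have mH : measurable_fun setT (fun w => g w * (rlker 2^-1 (w - s))%:E).
    apply: emeasurable_funM => //; apply: mr2; exact: measurable_funB.
  have H0 w : 0 <= g w * (rlker 2^-1 (w - s))%:E by rewrite mule_ge0 ?r0.
  have := ge0_integral_affine s (oner_neq0 R) mH H0.
  rewrite normr1 mul1e.
  under [X in _ = X -> _]eq_integral do rewrite mul1r addrK.
  move=> <-; rewrite -ge0_integralZr; last 4 first.
  - by [].
  - exact: mH.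
  - by move=> w _; exact: H0.
  - exact: r0.
  by apply: eq_integral => w _; rewrite -muleA -EFinM mulrC.
rewrite ge0_integralZl; last 4 first.
- by [].
- exact: (measurable_fun_integral2 (f := fun s w => G w s) mG').
- by move=> s _; exact: integral_ge0.
- by rewrite lee_fin sqrtr_ge0.
congr (_ * _).
rewrite (lebesgue_tonelli (f := fun s w => G w s) mG' (fun s w => G0 w s)).
apply: eq_integral => w _; rewrite /G ge0_integralZl; last 4 first.
- by [].
- under eq_fun do rewrite EFinM.
  apply: emeasurable_funM; first exact: mr2.
  apply: mr2; exact: measurable_funB.
- by move=> s _; rewrite EFinM mule_ge0 ?r0.
- exact: g0.
by rewrite rlker_conv.
Qed.

Lemma ge0_integral_sqnorm k (g : R -> \bar R) :
  measurable_fun setT g -> (forall x, 0 <= g x) ->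
  \int[lebesgue_tuple k.+1]_t g (@sqnorm R k.+1 t) =
  (Num.sqrt pi ^+ k.+1)%:E * \int[mu]_s (g s * (rlker (k.+1%:R / 2) s)%:E).
Proof.
elim: k g => [|k IH] g mg g0.
  rewrite ge0_integral_lebesgue_tupleS; last 2 first.
  - exact: measurableT_comp mg (@measurable_sqnorm R 1).
  - by move=> t; exact: g0.
  under eq_integral => x _.
    rewrite integral_lebesgue_tuple0; last first.
      apply: measurableT_comp mg _.
      apply: measurableT_comp (@measurable_sqnorm R 1) _.
      apply: measurableT_comp (@measurable_cons_tuple R 0) _.
      exact: measurable_fun_pair.
    rewrite sqnorm_cons sqnorm0 addr0.
    over.
  by rewrite (ge0_integral_sqr_rlker mg g0) expr1 div1r.
rewrite ge0_integral_lebesgue_tupleS; last 2 first.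
- exact: measurableT_comp mg (@measurable_sqnorm R k.+2).
- by move=> t; exact: g0.
have k2 : (0 < k.+1%:R / 2 :> R)%R by rewrite divr_gt0.
transitivity (\int[mu]_x ((Num.sqrt pi ^+ k.+1)%:E *
    \int[mu]_s (g (x ^+ 2 + s)%R * (rlker (k.+1%:R / 2) s)%:E))).
  apply: eq_integral => x _.
  under eq_integral do rewrite sqnorm_cons.
  rewrite (IH (fun s => g (x ^+ 2 + s)%R)) //.
  by apply: measurableT_comp mg _; exact: measurable_funD.
rewrite ge0_integralZl; last 4 first.
- by [].
- apply: measurable_fun_integral2.
    apply: emeasurable_funM.
      apply: measurableT_comp mg _; apply: measurable_funD => //.
      exact: measurable_funX.
    apply/measurable_EFinP; apply: measurableT_comp => //.
    exact: measurable_rlker.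
  by move=> x s; rewrite mule_ge0 // lee_fin rlker_ge0.
- move=> x _; apply: integral_ge0 => s _.
  by rewrite mule_ge0 // lee_fin rlker_ge0.
- by rewrite lee_fin exprn_ge0 ?sqrtr_ge0.
have -> : (k.+2%:R / 2 = k.+1%:R / 2 + 2^-1 :> R)%R.
  by rewrite -[in LHS]natr1 mulrDl div1r.
by rewrite (ge0_integral_sqr_conv mg g0 k2) muleA -EFinM -exprSr.
Qed.

End sqnorm_integral.

Section rotation_tuple.
Context {R : realType}.
Local Notation mu := (@lebesgue_measure R).
Local Notation T k := (k.-tuple (measurableTypeR R)).
Local Open Scope ereal_scope.

Lemma sqnorm_eq0_tdot k (e t : T k) : sqnorm e = 0%R -> tdot e t = 0%R.
Proof.
move=> /eqP; rewrite psumr_eq0 => [/allP e0|i _]; last exact: sqr_ge0.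
rewrite /tdot big1 // => i _.
by have := e0 i (mem_index_enum i); rewrite sqrf_eq0 => /eqP ->; rewrite mul0r.
Qed.

Lemma tdot_scale k (a : R) (e t : T k) :
  tdot [tuple (a * tnth e i)%R | i < k] t = (a * tdot e t)%R.
Proof.
rewrite /tdot mulr_sumr; apply: eq_bigr => i _.
by rewrite tnth_mktuple mulrA.
Qed.

Lemma sqnorm_scale k (a : R) (e : T k) :
  sqnorm ([tuple (a * tnth e i)%R | i < k] : T k) = (a ^+ 2 * sqnorm e)%R.
Proof.
rewrite /sqnorm mulr_sumr; apply: eq_bigr => i _.
by rewrite tnth_mktuple exprMn.
Qed.

Let measurable_radial_section k (G : R -> R -> \bar R) :
  measurable_fun setT
    (fun p : measurableTypeR R * measurableTypeR R => G p.1 p.2) ->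
  (forall x y, 0 <= G x y) ->
  measurable_fun setT (fun p : measurableTypeR R * measurableTypeR R =>
    \int[lebesgue_tuple k]_t G p.1 (p.2 + sqnorm t)%R).
Proof.
move=> mG G0.
apply: (measurable_fun_fubini_tonelli_F
  (fun q : (measurableTypeR R * measurableTypeR R) * T k =>
     G q.1.1 (q.1.2 + sqnorm q.2)%R)) => [|q]; last exact: G0.
apply: measurable_fun_comp2 mG _ _.
  exact: measurableT_comp measurable_fst measurable_fst.
apply: measurable_funD.
  exact: measurableT_comp measurable_snd measurable_fst.
exact: measurableT_comp (@measurable_sqnorm R k) measurable_snd.
Qed.

(** Here the unit vector is plus or minus the first axis, so at most a reflection of [x] is
    involved. *)
Let ge0_integral_tdot_axis k (e : R) (es : T k) (G : R -> R -> \bar R) :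
  measurable_fun setT
    (fun p : measurableTypeR R * measurableTypeR R => G p.1 p.2) ->
  (forall x y, 0 <= G x y) -> (e ^+ 2 + sqnorm es = 1)%R -> sqnorm es = 0%R ->
  \int[mu]_x \int[lebesgue_tuple k]_t G (e * x + tdot es t)%R (x ^+ 2 + sqnorm
    t)%R =
  \int[mu]_x \int[lebesgue_tuple k]_t G x (x ^+ 2 + sqnorm t)%R.
Proof.
move=> mG G0 e1 es0; rewrite es0 addr0 in e1.
pose H x := \int[lebesgue_tuple k]_t G x (x ^+ 2 + sqnorm t)%R.
have mH : measurable_fun setT H.
  apply: (@measurable_fun_comp2 R _ (measurableTypeR R)
    (fun a b => \int[lebesgue_tuple k]_t G a (b + sqnorm t)%R) id
    (fun x => x ^+ 2)%R (measurable_radial_section k mG G0)) => //.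
have H0 x : 0 <= H x by exact: integral_ge0.
have en0 : e != 0%R.
  by apply: contra_eq_neq e1 => ->; rewrite expr0n /= eq_sym oner_neq0.
have ne1 : `|e|%R = 1%R.
  by apply/eqP; rewrite -(@eqrXn2 _ 2%N) // expr1n -normrX e1 normr1.
rewrite [RHS](ge0_integral_affine 0%R en0 mH H0) ne1 mul1e.
apply: eq_integral => x _; rewrite /H; apply: eq_integral => t _.
by rewrite (sqnorm_eq0_tdot _ es0) !addr0 exprMn e1 mul1r.
Qed.

(** Rotation invariance by induction on the dimension: the induction hypothesis turns the tail of
    [e] into an axis, which leaves a rotation in the plane of that axis and the first one. *)
Lemma ge0_integral_tdot k (e : T k.+1) (G : R -> R -> \bar R) :
  measurable_fun setT
    (fun p : measurableTypeR R * measurableTypeR R => G p.1 p.2) ->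
  (forall x y, 0 <= G x y) -> sqnorm e = 1%R ->
  \int[lebesgue_tuple k.+1]_t G (tdot e t) (sqnorm t) =
  \int[mu]_x \int[lebesgue_tuple k]_t G x (x ^+ 2 + sqnorm t)%R.
Proof.
elim: k e G => [|k IH] e G mG G0; rewrite -(cons_tupleK e);
  move: (thead e) [tuple of behead e] => {}e es; rewrite sqnorm_cons => e1.
all: rewrite ge0_integral_lebesgue_tupleS; first last.
all: try by move=> t; exact: G0.
all: try by apply: measurable_fun_comp2 mG _ _;
  [exact: measurable_tdot | exact: measurable_sqnorm].
all: under eq_integral do under eq_integral do rewrite tdot_cons sqnorm_cons.
all: have [es0|es0] := eqVneq (sqnorm es) 0%R.
- exact: ge0_integral_tdot_axis.
- by case/eqP: es0; exact: sqnorm0.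
- exact: ge0_integral_tdot_axis.
have esgt0 : (0 < sqnorm es)%R by rewrite lt0r es0 sqnorm_ge0.
(* The pair [(e, s)] is the unit vector of that plane, and [es / s] is the unit vector to which the
   induction hypothesis applies. *)
pose s := Num.sqrt (sqnorm es).
have s2 : (s ^+ 2 = sqnorm es)%R by rewrite sqr_sqrtr ?sqnorm_ge0.
have s0 : s != 0%R by rewrite sqrtr_eq0 -ltNge.
have es'1 : sqnorm ([tuple (s^-1 * tnth es i)%R | i < k.+1] : T k.+1) = 1%R.
  by rewrite sqnorm_scale exprVn s2 mulVf.
pose K a b := \int[lebesgue_tuple k]_t G a (b + sqnorm t)%R.
have mK : measurable_fun setT
    (fun p : measurableTypeR R * measurableTypeR R => K p.1 p.2).
  exact: measurable_radial_section.
have K0 a b : 0 <= K a b by exact: integral_ge0.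
transitivity (\int[mu]_x \int[mu]_y K (e * x + s * y)%R (x ^+ 2 + y ^+ 2)%R).
  apply: eq_integral => x _.
  pose G' a b := G (e * x + s * a)%R (x ^+ 2 + b)%R.
  have mG' : measurable_fun setT
      (fun p : measurableTypeR R * measurableTypeR R => G' p.1 p.2).
    apply: measurable_fun_comp2 mG _ _; apply: measurable_funD => //.
    exact: measurable_funM.
  transitivity (\int[lebesgue_tuple k.+1]_t
      G' (tdot ([tuple (s^-1 * tnth es i)%R | i < k.+1] : T k.+1) t) (sqnorm
        t)).
    by apply: eq_integral => t _; rewrite /G' tdot_scale mulVKf.
  rewrite (IH _ G' mG' (fun a b => G0 _ _) es'1).
  apply: eq_integral => y _; rewrite /K /G'.
  by apply: eq_integral => t _; rewrite addrA.
rewrite (ge0_integral_rotation mK K0 _ s0); last by rewrite s2.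
apply: eq_integral => x _.
rewrite ge0_integral_lebesgue_tupleS; last 2 first.
- apply: measurable_fun_comp2 mG _ _; first exact: measurable_cst.
  by apply: measurable_funD => //; exact: measurable_sqnorm.
- by move=> t; exact: G0.
apply: eq_integral => y _; rewrite /K; apply: eq_integral => t _.
by rewrite sqnorm_cons addrA.
Qed.

End rotation_tuple.

Section sphere_integral.
Context {R : realType}.
Local Notation mu := (@lebesgue_measure R).
Local Notation T k := (k.-tuple (measurableTypeR R)).
Local Open Scope ereal_scope.

Lemma tnormE k (t : T k) : tnorm t = Num.sqrt (sqnorm t).
Proof. by []. Qed.

Lemma measurable_unit_sphere k : measurable (@unit_sphere R k).
Proof.
rewrite (_ : @unit_sphere R k = setT `&` (@tnorm R k) @^-1` [set 1%R]).
  exact: measurable_tnorm.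
by rewrite setTI.
Qed.

(** [sphere_measure] is [k] times the image under [normalize] of Lebesgue measure on the punctured
    unit ball, and normalised points lie on the sphere. *)
Lemma ge0_integral_sphere_measure k (G : T k -> \bar R) :
  measurable_fun setT G -> (forall t, 0 <= G t) ->
  \int[@sphere_measure R k]_(t in @unit_sphere R k) G t =
  k%:R%:E * \int[lebesgue_tuple k]_t
    (G (normalize t) * ((0 < tnorm t <= 1)%R%:R)%:E).
Proof.
move=> mG G0.
pose D : set (T k) := [set t | (0 < tnorm t <= 1)%R].
have mD : measurable D.
  rewrite (_ : D = setT `&` (@tnorm R k) @^-1` `]0%R, 1%R]).
    exact: measurable_tnorm.
  by rewrite setTI; apply/seteqP; split => t; rewrite /D /= in_itv.
pose nu : {measure set (T k) -> \bar R} :=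
  measure_function_pushforward__canonical__measure_function_Measure
    (mrestr (lebesgue_tuple k) mD) (@measurable_normalize R k).
have k0 : (0 <= k%:R :> R)%R by [].
have mGS : measurable_fun setT (G \_ (@unit_sphere R k)).
  by apply: (measurable_restrictT G (@measurable_unit_sphere k)).1;
    exact: measurable_funTS.
have GS0 t : 0 <= (G \_ (@unit_sphere R k)) t.
  by rewrite patchE; case: ifP.
rewrite integral_mkcond.
transitivity (\int[mscale (NngNum k0) nu]_t (G \_ (@unit_sphere R k)) t).
  apply: eq_measure_integral => A mA _.
  rewrite /= /sphere_measure /mscale /= /pushforward /mrestr; congr (_ * _).
  by rewrite setIC.
rewrite ge0_integral_mscale; last 3 first.
- by [].
- exact: mGS.
- by move=> t _; exact: GS0.
congr (_ * _).
rewrite (ge0_integral_pushforward (@measurable_normalize R k)); last 3 first.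
- by [].
- exact: mGS.
- by move=> t _; exact: GS0.
rewrite preimage_setT.
transitivity (\int[lebesgue_tuple k]_t
   (((G \_ (@unit_sphere R k)) \o @normalize R k) t * (\1_D t)%:E)).
  apply: ge0_integral_density.
  - exact: measurable_indic.
  - by [].
  - move=> A mA; rewrite integral_indic // /mrestr setIC //.
  - exact: measurableT_comp mGS (@measurable_normalize R k).
  - by move=> t; exact: GS0.
apply: eq_integral => t _; rewrite indicE /=.
have -> : (t \in D) = (0 < tnorm t <= 1)%R by apply/idP/idP; rewrite inE.
have [/andP[t0 t1]|_] := boolP (0 < tnorm t <= 1)%R; last by rewrite !mule0.
rewrite !mule1 patchE mem_set // /unit_sphere /=.
rewrite tnormE /sqnorm /normalize.
under eq_bigr do rewrite tnth_mktuple expr_div_n.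
rewrite -mulr_suml -[X in (X / _)%R]/(sqnorm t) -[X in (X / _)%R]sqr_sqrtr
  ?sqnorm_ge0 //.
by rewrite -tnormE divff ?sqrtr1 // sqrf_eq0 gt_eqF.
Qed.

(* Substitute [b = x^2 + s], then [x = sqrt b c]; the integral over [b] factors
   out. *)
Lemma ge0_integral_cone (g : R -> \bar R) a :
  measurable_fun setT g -> (forall x, 0 <= g x) -> (0 < a)%R ->
  \int[mu]_x \int[mu]_s (g (x / Num.sqrt (x ^+ 2 + s))%R *
    ((0 < x ^+ 2 + s <= 1)%R%:R * rlker a s)%:E) =
  ((a + 2^-1)^-1)%:E * \int[mu]_c (g c * (rlker a (1 - c ^+ 2))%:E).
Proof.
move=> mg g0 a0.
pose C := \int[mu]_c (g c * (rlker a (1 - c ^+ 2))%:E).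
pose I (b : R) : R := ((0 < b <= 1)%R%:R)%R.
pose F (x b : R) := g (x / Num.sqrt b)%R * (I b * rlker a (b - x ^+ 2))%:E.
have mI : measurable_fun setT I.
  rewrite (_ : I = \1_(`]0%R, 1%R]%classic)) //.
  by apply/funext => b; rewrite indicE mem_setE in_itv.
have I0 b : (0 <= I b)%R by rewrite /I ler0n.
have r0 x : (0 <= rlker a x)%R by exact: rlker_ge0.
have F0 x b : 0 <= F x b by rewrite mule_ge0 // lee_fin mulr_ge0.
have mF : measurable_fun setT
    (fun p : measurableTypeR R * measurableTypeR R => F p.1 p.2).
  apply: emeasurable_funM.
    apply: measurableT_comp mg _.
    under eq_fun => p.
      rewrite -powR_inv1 ?sqrtr_ge0 //.
      over.
    apply: measurable_funM => //.
    apply: (measurableT_comp (measurable_powR _)).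
    apply: (measurableT_comp _ measurable_snd).
    exact: continuous_measurable_fun (@sqrt_continuous R).
  apply/measurable_EFinP/measurable_funM.
    exact: measurableT_comp mI measurable_snd.
  apply: (measurableT_comp (@measurable_rlker R a)).
  apply: measurable_funB => //; exact: measurable_funX.
have mF1 x : measurable_fun setT (F x).
  exact: (measurable_fun_pair2 x mF).
transitivity (\int[mu]_x \int[mu]_b F x b).
  apply: eq_integral => x _.
  rewrite (ge0_integral_affine (x ^+ 2)%R (oner_neq0 R) (mF1 x) (F0 x)).
  rewrite normr1 mul1e; apply: eq_integral => s _.
  by rewrite /F mul1r addrK addrC.
rewrite (lebesgue_tonelli mF F0).
transitivity (\int[mu]_b ((fun b : R => (b `^ (a + 2^-1 - 1))%:E) \_ `]0%R, 1%R]
  b * C)).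
  apply: eq_integral => b _; rewrite /F patchE mem_setE in_itv /= /I.
  have [/andP[b0 b1]|_] := boolP (0 < b <= 1)%R; last first.
    by rewrite mul0e integral0_eq // => x _; rewrite mul0r mule0.
  have sb0 : Num.sqrt b != 0%R by rewrite sqrtr_eq0 -ltNge.
  have mH : measurable_fun setT (fun x : R =>
      g (x / Num.sqrt b)%R * (1 * rlker a (b - x ^+ 2))%:E).
    apply: emeasurable_funM.
      by apply: measurableT_comp mg _; exact: measurable_funM.
    apply/measurable_EFinP/measurable_funM => //.
    apply: (measurableT_comp (@measurable_rlker R a)).
    apply: measurable_funB => //; exact: exprn_measurable.
  rewrite (ge0_integral_affine 0%R sb0 mH); last first.
    by move=> x; rewrite mule_ge0 // lee_fin mulr_ge0.
  rewrite ger0_norm ?sqrtr_ge0 //.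
  transitivity ((Num.sqrt b)%:E * \int[mu]_c ((b `^ (a - 1))%:E *
      (g c * (rlker a (1 - c ^+ 2))%:E))).
    congr (_ * _); apply: eq_integral => c _.
    rewrite addr0 mulrAC divff // !mul1r muleCA -EFinM; congr (_ * _%:E).
    rewrite exprMn sqr_sqrtr ?(ltW b0) // -[X in (X - b * _)%R]mulr1 -mulrBr.
    by rewrite /rlker pospowM // mulrCA.
  rewrite ge0_integralZl; last 4 first.
  - by [].
  - apply: emeasurable_funM => //; apply/measurable_EFinP.
    apply: (measurableT_comp (@measurable_rlker R a)).
    apply: measurable_funB => //; exact: exprn_measurable.
  - by move=> c _; rewrite mule_ge0 // lee_fin.
  - by rewrite lee_fin powR_ge0.
  rewrite -/C muleA -EFinM; congr (_%:E * _).
  (* The Jacobian [sqrt b] times [b^(a - 1)] from the kernel is [b^(a + 1/2 - 1)]; its integral over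
     []0, 1]] is the factor [1 / (a + 1/2)]. *)
  rewrite -powR12_sqrt ?(ltW b0) // -powRD ?(gt_eqF b0) ?implybT //.
  by congr (_ `^ _)%R; ring.
rewrite ge0_integralZr; last 4 first.
- by [].
- apply/(measurable_restrictT _ _).1 => //.
  by apply/measurable_funTS/measurable_EFinP; exact: measurable_powR.
- by move=> b _; rewrite patchE; case: ifP; rewrite ?lee_fin ?powR_ge0.
- by apply: integral_ge0 => c _; rewrite mule_ge0 // lee_fin.
rewrite -integral_mkcond integral_powR ?addr_gt0 ?invr_gt0 //.
by rewrite powR1 div1r.
Qed.

(** After rotating [e] to the first axis the other [k + 1] coordinates enter only through their
    squared norm, whose law has the kernel of order [(k + 1) / 2]. The dimension is at least 2 so
    that this order is positive. *)
Lemma ge0_integral_sphere_tdot k (e : T k.+2) (g : R -> \bar R) :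
  measurable_fun setT g -> (forall x, 0 <= g x) -> sqnorm e = 1%R ->
  \int[@sphere_measure R k.+2]_(t in @unit_sphere R k.+2) g (tdot e t) =
  (2 * Num.sqrt pi ^+ k.+1)%:E *
  \int[mu]_c (g c * (rlker (k.+1%:R / 2) (1 - c ^+ 2))%:E).
Proof.
move=> mg g0 e1.
rewrite (ge0_integral_sphere_measure (G := fun t => g (tdot e t)));
  last 2 first.
- exact: measurableT_comp mg (measurable_tdot e).
- by move=> t; exact: g0.
pose G x b := g (x / Num.sqrt b)%R * ((0 < b <= 1)%R%:R)%:E.
have a0 : (0 < k.+1%:R / 2 :> R)%R by rewrite divr_gt0.
have mG : measurable_fun setT
    (fun p : measurableTypeR R * measurableTypeR R => G p.1 p.2).
  apply: emeasurable_funM.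
    apply: measurableT_comp mg _.
    under eq_fun => p.
      rewrite -powR_inv1 ?sqrtr_ge0 //.
      over.
    apply: measurable_funM => //.
    apply: (measurableT_comp (measurable_powR _)).
    apply: (measurableT_comp _ measurable_snd).
    exact: continuous_measurable_fun (@sqrt_continuous R).
  apply/measurable_EFinP.
  apply: (measurableT_comp (f := fun b : R => ((0 < b <= 1)%R%:R : R)%R) _
    measurable_snd).
  rewrite (_ : (fun b : R => _) = \1_(`]0%R, 1%R]%classic)) //.
  by apply/funext => b; rewrite indicE mem_setE in_itv.
have G0 x b : 0 <= G x b by rewrite mule_ge0 // lee_fin ler0n.
transitivity (k.+2%:R%:E * \int[lebesgue_tuple k.+2]_t G (tdot e t) (sqnorm t)).
  congr (_ * _); apply: eq_integral => t _; rewrite /G.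
  rewrite tnormE sqrtr_gt0 -[X in (_ <= X)%R]sqrtr1 ler_sqrt ?sqrtr1 //.
  congr (g _ * _); rewrite /tdot mulr_suml; apply: eq_bigr => i _.
  by rewrite tnth_mktuple mulrA.
rewrite (ge0_integral_tdot mG G0 e1).
have mG1 x : measurable_fun setT (G x) by exact: (measurable_fun_pair2 x mG).
pose H x s := G x (x ^+ 2 + s)%R * (rlker (k.+1%:R / 2) s)%:E.
have H0 x s : 0 <= H x s by rewrite mule_ge0 // lee_fin rlker_ge0.
have mH : measurable_fun setT
    (fun p : measurableTypeR R * measurableTypeR R => H p.1 p.2).
  apply: emeasurable_funM.
    apply: (measurable_fun_comp2 mG) => //; apply: measurable_funD => //.
    exact: measurable_funX.
  apply/measurable_EFinP.
  exact: (measurableT_comp (@measurable_rlker R _) measurable_snd).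
transitivity (k.+2%:R%:E * \int[mu]_x ((Num.sqrt pi ^+ k.+1)%:E * \int[mu]_s H x
  s)).
  congr (_ * _); apply: eq_integral => x _.
  rewrite (@ge0_integral_sqnorm R k (fun s => G x (x ^+ 2 + s)%R)) //.
  by apply: measurableT_comp (mG1 x) _; exact: measurable_funD.
rewrite ge0_integralZl; last 4 first.
- by [].
- exact: measurable_fun_integral2 mH H0.
- by move=> x _; exact: integral_ge0.
- by rewrite lee_fin exprn_ge0 ?sqrtr_ge0.
have -> : \int[mu]_x \int[mu]_s H x s = \int[mu]_x \int[mu]_s
    (g (x / Num.sqrt (x ^+ 2 + s))%R *
    ((0 < x ^+ 2 + s <= 1)%R%:R * rlker (k.+1%:R / 2) s)%:E).
  apply: eq_integral => x _; apply: eq_integral => s _.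
  by rewrite /H /G -muleA -EFinM.
rewrite (ge0_integral_cone mg g0 a0) !muleA -!EFinM; congr (_%:E * _).
(* The factor [k + 2] of the cone definition meets [1 / ((k + 2) / 2)] from the radial integral,
   which leaves 2. *)
have k0 : (k.+2%:R != 0 :> R)%R by rewrite pnatr_eq0.
have -> : (k.+1%:R / 2 + 2^-1 = k.+2%:R / 2 :> R)%R.
  by rewrite -[in RHS]natr1 mulrDl div1r.
by rewrite invf_div mulrAC mulrCA divff // mulr1.
Qed.

End sphere_integral.

(** * Fractional integrals and derivatives *)

Section fractional_integral.
Context {R : realType}.
Local Notation mu := (@lebesgue_measure R).
Local Open Scope ereal_scope.

(* Divergent integrals included, so that [H] is the fractional integral of [F] at
   every point and not only almost everywhere. *)
Lemma integralZl_gt0 d (T : measurableType d) (m : {measure set T -> \bar R})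
    (D : set T) (c : R) (f : T -> \bar R) :
  measurable D -> measurable_fun D f -> (0 < c)%R ->
  \int[m]_(x in D) (c%:E * f x) = c%:E * \int[m]_(x in D) f x.
Proof.
move=> mD mf c0; rewrite integralE [in RHS]integralE.
rewrite (ge0_funeposM _ (ltW c0)) (ge0_funenegM _ (ltW c0)).
rewrite !ge0_integralZl_EFin ?(ltW c0) //; last 2 first.
- exact: measurable_funeneg.
- exact: measurable_funepos.
have p0 : 0 <= \int[m]_(x in D) f^\+ x by exact: integral_ge0.
have n0 : 0 <= \int[m]_(x in D) f^\- x by exact: integral_ge0.
move: p0 n0; case: (\int[m]_(x in D) f^\+ x) => [p||] //;
  case: (\int[m]_(x in D) f^\- x) => [q||] // _ _.
- by rewrite -!EFinM -!EFinB mulrBr.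
- by rewrite gt0_muley ?lte_fin //= gt0_muleNy ?lte_fin.
- by rewrite gt0_muley ?lte_fin //= gt0_muley ?lte_fin.
- by rewrite gt0_muley ?lte_fin //= gt0_muleNy ?lte_fin.
Qed.

Lemma measurable_fun_integral (f : R -> R -> \bar R) :
  measurable_fun setT
    (fun p : measurableTypeR R * measurableTypeR R => f p.1 p.2) ->
  measurable_fun setT (fun x => \int[mu]_y f x y).
Proof.
move=> mf.
rewrite (_ : (fun x => _) = (fun x => \int[mu]_y (f x)^\+ y) \-
   (fun x => \int[mu]_y (f x)^\- y)); last first.
  by apply/funext => x; rewrite integralE.
apply: emeasurable_funB.
  apply: (@measurable_fun_integral2 R (fun x y => (f x)^\+ y)).
    rewrite (_ : (fun p => _) = (fun p => f p.1 p.2)^\+).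
    exact: measurable_funepos.
  by apply/funext => p; rewrite !funeposE.
  by move=> x y; exact: funepos_ge0.
apply: (@measurable_fun_integral2 R (fun x y => (f x)^\- y)).
  rewrite (_ : (fun p => _) = (fun p => f p.1 p.2)^\-).
    exact: measurable_funeneg.
  by apply/funext => p; rewrite !funenegE.
by move=> x y; exact: funeneg_ge0.
Qed.

(** The kernel discards [u <= v], and the right endpoint 1 is encoded in functions that vanish from
    1 on, so no interval appears. *)
Definition efracint a (F : R -> R) v : \bar R :=
  \int[mu]_u (F u * rlker a (u - v))%:E.

(* [fine] turns a divergent integral into [0]. *)
Definition fracint a (F : R -> R) v : R := fine (efracint a F v).

Lemma measurable_fracint a (F : R -> R) :
  measurable_fun setT F -> measurable_fun setT (fracint a F).
Proof.
move=> mF; apply: measurableT_comp; first exact: fine_measurable.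
apply: measurable_fun_integral; apply/measurable_EFinP/measurable_funM.
  exact: measurableT_comp mF measurable_snd.
apply: (measurableT_comp (@measurable_rlker R a)); exact: measurable_funB.
Qed.

Section semigroup.
Variables (F : R -> R) (a b v : R).
Hypotheses (mF : measurable_fun setT F) (a0 : (0 < a)%R) (b0 : (0 < b)%R).
Hypothesis iF :
  mu.-integrable setT (fun u => (F u * rlker (a + b) (u - v))%:E).

Let f (p : measurableTypeR R * measurableTypeR R) : \bar R :=
  (rlker b (p.1 - v) * (F p.2 * rlker a (p.2 - p.1)))%:E.

Let mf : measurable_fun setT f.
Proof.
apply/measurable_EFinP/measurable_funM.
  apply: (measurableT_comp (@measurable_rlker R b)); exact: measurable_funB.
apply: measurable_funM; first exact: measurableT_comp mF measurable_snd.
apply: (measurableT_comp (@measurable_rlker R a)); exact: measurable_funB.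
Qed.

Let conv u : \int[mu]_y (rlker b (y - v) * rlker a (u - y))%:E =
  (rlker (a + b) (u - v))%:E.
Proof.
rewrite addrC -(rlker_conv _ b0 a0).
pose g y : \bar R := (rlker b y * rlker a (u - v - y))%:E.
have mg : measurable_fun setT g.
  apply/measurable_EFinP/measurable_funM; first exact: measurable_rlker.
  apply: (measurableT_comp (@measurable_rlker R a)); exact: measurable_funB.
have g0 y : 0 <= g y by rewrite lee_fin mulr_ge0 ?rlker_ge0.
rewrite -[RHS](ge0_integral_subr v mg g0).
by apply: eq_integral => y _; congr ((_ * rlker _ _)%:E); ring.
Qed.

Let mk (u : R) : measurable_fun setT (fun y : R => (rlker b (y - v) * rlker a (u
  - y))%:E).
Proof.
apply/measurable_EFinP/measurable_funM.
  apply: (measurableT_comp (@measurable_rlker R b)); exact: measurable_funB.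
apply: (measurableT_comp (@measurable_rlker R a)); exact: measurable_funB.
Qed.

Let k0 (u y : R) : 0 <= (rlker b (y - v) * rlker a (u - y))%:E :> \bar R.
Proof. by rewrite lee_fin mulr_ge0 ?rlker_ge0. Qed.

(** For absolute values, integrate in [y] first: the two kernels convolve to the one of order
    [a + b], against which [F] is integrable by [iF]. *)
Let imf : (mu \x mu).-integrable setT f.
Proof.
apply: (integrable21ltyP mu mu mf).2; move/integrableP : iF => [_].
rewrite (_ : \int[mu]_u `|(F u * rlker (a + b) (u - v))%:E| =
  \int[mu]_u \int[mu]_y `|f (y, u)|) //.
apply: eq_integral => u _; rewrite EFinM abseM -conv.
rewrite [X in _ * X]gee0_abs; last by apply: integral_ge0 => y _; exact: k0.
rewrite -ge0_integralZl; last 4 first.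
- by [].
- exact: mk.
- by move=> y _; exact: k0.
- by [].
apply: eq_integral => y _.
rewrite /f /= [in RHS]mulrCA normrM -EFinM; congr (_ * _)%:E.
by rewrite ger0_norm // mulr_ge0 // rlker_ge0.
Qed.

Let fubini_FE (y : R) : fubini_F mu f y = (rlker b (y - v))%:E * efracint a F y.
Proof.
rewrite /fubini_F /f /=.
have := rlker_ge0 (y - v) b0; rewrite le_eqVlt => /predU1P[<-|r0].
  by rewrite mul0e integral0_eq // => u _; rewrite mul0r.
under eq_integral do rewrite EFinM.
rewrite integralZl_gt0 //; apply/measurable_EFinP/measurable_funM => //.
apply: (measurableT_comp (@measurable_rlker R a)); exact: measurable_funB.
Qed.

(** By Fubini the inner integral is finite for almost every [y]; there [fine] is harmless wherever
    the outer kernel is nonzero. Hence the default value in [fracint] alters the outer integrand on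
    a null set only. *)
Let ae_fubini_F : ae_eq mu setT (fubini_F mu f)
  (fun y : R => (fracint a F y * rlker b (y - v))%:E).
Proof.
have /(integrable_ae measurableT) := integrable_fubini_F imf.
apply: filterS => y /(_ I) + _; rewrite fubini_FE /fracint.
have := rlker_ge0 (y - v) b0; rewrite le_eqVlt => /predU1P[<-|r0].
  by rewrite mul0e mulr0.
move: (rlker b (y - v)) r0 => r r0.
case: (efracint a F y) => [s||] /=.
- by rewrite -EFinM mulrC.
- by rewrite gt0_muley ?lte_fin.
- by rewrite gt0_muleNy ?lte_fin.
Qed.

Let mJ : measurable_fun setT (fun y : R => (fracint a F y * rlker b (y -
  v))%:E).
Proof.
apply/measurable_EFinP/measurable_funM; first exact: measurable_fracint.
apply: (measurableT_comp (@measurable_rlker R b)); exact: measurable_funB.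
Qed.

Lemma integrable_fracint_rlker :
  mu.-integrable setT (fun y : R => (fracint a F y * rlker b (y - v))%:E).
Proof.
apply/integrableP; split; first exact: mJ.
have /integrableP[_] := integrable_fubini_F imf.
apply: le_lt_trans; rewrite le_eqVlt; apply/orP; left; apply/eqP.
apply: ge0_ae_eq_integral => //.
- exact: measurableT_comp mJ.
- apply: measurableT_comp => //; exact: measurable_fubini_F imf.
- by apply: filterS ae_fubini_F => y /(_ I) -> _.
Qed.

Lemma fracint_semigroup : fracint b (fracint a F) v = fracint (a + b) F v.
Proof.
rewrite /fracint; congr fine; rewrite {1}/efracint.
transitivity (\int[mu]_y fubini_F mu f y).
  apply: ae_eq_integral => //.
  - exact: measurable_fubini_F imf.
  - by apply: ae_eq_sym.
rewrite /fubini_F (Fubini imf); apply: eq_integral => u _.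
rewrite EFinM -conv -integralZl //.
  by apply: eq_integral => y _; rewrite /f /= [in LHS]mulrCA [in LHS]EFinM.
apply/integrableP; split; first exact: mk.
under eq_integral do rewrite gee0_abs //.
by rewrite conv ltry.
Qed.

End semigroup.

End fractional_integral.

(** * Differentiation of the integral of order one *)

Section primitive.
Context {R : realType}.
Local Notation mu := (@lebesgue_measure R).
Variables (phi : R -> R).
Hypothesis phi1 : forall u, 1 <= u -> phi u = 0.
Hypothesis iphi : forall e, 0 < e < 1 -> mu.-integrable `]e, 1[ (EFin \o phi).

Lemma Gamma1 : Gamma 1 = 1 :> R.
Proof. by apply: EFin_inj; rewrite EFin_Gamma // gammae1. Qed.

Lemma rlker1 x : rlker 1 x = (0 < x)%R%:R :> R.
Proof.
rewrite /rlker Gamma1 invr1 mul1r subrr /pospow powRr0.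
by case: ifP.
Qed.

(** Integrability of [phi] may fail at 0. Cutting at some [e < v] gives a function integrable on the
    line without changing [fracint 1 phi] near [v]. *)
Let phie e := phi \_ `]e, 1[.

Let integrable_phie e A : 0 < e < 1 -> measurable A ->
  mu.-integrable A (EFin \o phie e).
Proof.
move=> e01 mA; apply: (@integrableS _ _ _ mu setT) => //.
rewrite /phie -restrict_EFin; apply/(integrable_mkcond _ _).1 => //.
exact: iphi.
Qed.

Let fracint1E e y : 0 < e < 1 -> e < y < 1 ->
  fracint 1 phi y = \int[mu]_(u in `[e, 1]) phie e u -
                    \int[mu]_(u in `[e, y]) phie e u.
Proof.
move=> e01 /andP[ey y1].
rewrite Rintegral_itvB ?bnd_simp ?ltW //; last exact: integrable_phie.
rewrite /fracint /efracint /Rintegral; congr fine.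
rewrite [RHS]integral_mkcond; apply: eq_integral => u _.
rewrite patchE mem_setE in_itv /= /phie patchE mem_setE in_itv /= rlker1
  subr_gt0.
have [yu|_] := ltP y u; last by rewrite mulr0.
rewrite (lt_trans ey yu) mulr1 /=.
have [u1|u1] := ltP u 1; first by rewrite ltW.
by rewrite phi1 // if_same.
Qed.

Let near_fracint1 e (v : R) : 0 < e < v -> v < 1 -> \forall y \near v,
  \int[mu]_(u in `[e, 1]) phie e u - \int[mu]_(u in `[e, y]) phie e u =
  fracint 1 phi y.
Proof.
move=> /andP[e0 ev] v1; have e01 : 0 < e < 1 by rewrite e0 (lt_trans ev).
near=> y; apply/esym/fracint1E => //; apply/andP; split; near: y.
  exact: lt_nbhsr.
exact: lt_nbhsl.
Unshelve. all: end_near. Qed.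

Lemma continuous_fracint1 (v : R) : 0 < v < 1 -> {for v, continuous (fracint 1
  phi)}.
Proof.
move=> /andP[v0 v1]; pose e := v / 2.
have ev : 0 < e < v by rewrite divr_gt0 // gtr_pMr // invf_lt1 // ltr1n.
have [e0 ev'] := andP ev.
have e01 : 0 < e < 1 by rewrite e0 (lt_trans ev').
have nv := near_fracint1 ev v1.
have cP : {for v, continuous (fun y => \int[mu]_(u in `[e, y]) phie e u)}.
  have := parameterized_integral_continuous (ltW (andP e01).2)
    (integrable_phie e01 (measurable_itv `[e, 1])).
  move=> /continuous_within_itvP - /(_ (andP e01).2)[+ _ _]; apply.
  by rewrite in_itv /= ev' v1.
have /= nvv := nbhs_singleton nv.
rewrite /prop_for /continuous_at -nvv.
apply: cvg_trans (near_eq_cvg nv) _.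
by apply: cvgB; [exact: cvg_cst | exact: cP].
Qed.

(** Near [v] the function is a constant minus the primitive of [phie e] from [e]; the variable is a
    lower limit of integration, whence the sign. *)
Lemma is_derive_fracint1 e (v : R) : 0 < e < v -> v < 1 ->
  lebesgue_pt (phi \_ `]e, 1[) v -> is_derive v 1 (fracint 1 phi) (- phi v).
Proof.
move=> ev v1 Lv; have [e0 ev'] := andP ev.
have e01 : 0 < e < 1 by rewrite e0 (lt_trans ev').
have [dF F'] := FTC1_lebesgue_pt (a := BLeft e) v1
  (integrable_phie e01 (measurable_itv `[e, 1])) ev' Lv.
apply: near_eq_is_derive (near_fracint1 ev v1) _.
have -> : - phi v = 0 - phie e v.
  by rewrite sub0r /phie patchE mem_setE in_itv /= ev' v1.
apply: is_deriveB.
apply: DeriveDef; first exact: dF.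
by rewrite -derive1E; exact: F'.
Qed.

Lemma ae_is_derive_fracint1 :
  {ae mu, forall v : R, 0 < v < 1 -> is_derive v 1 (fracint 1 phi) (- phi v)}.
Proof.
(* The Lebesgue points depend on the cut; countably many cuts tending to 0 give one null set that
   serves every [v]. *)
pose e (n : nat) : R := n.+2%:R^-1.
have e01 n : 0 < e n < 1 by rewrite invr_gt0 ltr0n invf_lt1 // ltr1n.
have : {ae mu, forall v, forall n, lebesgue_pt (phi \_ `]e n, 1[) v}.
  apply: ae_foralln => n; apply: lebesgue_differentiation.
  by apply: integrable_locally => //; exact: iphi.
apply: filterS; first exact: (ae_filter_ringOfSetsType mu).
move=> v Lv /andP[v0 v1].
have [n nv] : exists n, e n < v.
  exists (Num.bound v^-1); rewrite /e invf_plt ?posrE //.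
  by rewrite (lt_trans (archi_boundP _)) ?invr_ge0 ?(ltW v0) // ltr_nat.
by apply: (@is_derive_fracint1 (e n)) => //; rewrite nv (andP (e01 n)).1.
Qed.

(** A point of continuity is a Lebesgue point of the cut function, which agrees with [phi] near
    it. *)
Lemma continuous_is_derive_fracint1 (v : R) : 0 < v < 1 -> {for v, continuous
  phi} ->
  is_derive v 1 (fracint 1 phi) (- phi v).
Proof.
move=> /andP[v0 v1] cv; pose e := v / 2.
have ev : 0 < e < v by rewrite divr_gt0 // gtr_pMr // invf_lt1 // ltr1n.
have [e0 ev'] := andP ev.
have e01 : 0 < e < 1 by rewrite e0 (lt_trans ev').
apply: (is_derive_fracint1 ev v1).
have vin : v \in `]e, 1[ by rewrite in_itv /= ev' v1.
have mphie : measurable_fun `]e, 1[ (phi \_ `]e, 1[).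
  have /integrableP[/measurable_EFinP mphi _] := iphi e01.
  apply: measurable_funTS; apply: (measurable_restrictT _ _).1 => //.
have ov : open_nbhs v `]e, 1[%classic by split;
  [exact: interval_open|exact: vin].
apply: (continuous_lebesgue_pt ov _ mphie); first exact: measurable_itv.
rewrite /prop_for /continuous_at patchE mem_setE vin.
apply: cvg_trans cv; apply: near_eq_cvg.
near=> y; rewrite patchE mem_setE; have -> : y \in `]e, 1[ => //.
rewrite in_itv /=; apply/andP; split; near: y; first exact: lt_nbhsr.
exact: lt_nbhsl.
Unshelve. all: end_near. Qed.

End primitive.

(** * Inversion of the fractional integral *)

Section RLderiv_fracint.
Context {R : realType}.
Local Notation mu := (@lebesgue_measure R).
Variable F : R -> R.
Hypothesis mF : measurable_fun setT F.
Hypothesis F1 : forall u, 1 <= u -> F u = 0.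
Hypothesis iF : forall e, 0 < e < 1 -> mu.-integrable `]e, 1[ (EFin \o F).

(** For [c >= 1] and [0 < v < u < 1] the kernel is at most [1 / Gamma c], so [F] integrable on []v,
    1[] is enough, at every [v]. For orders below 1 convergence may fail at individual points. *)
Let integrable_rlker c (v : R) : 1 <= c -> 0 < v < 1 ->
  mu.-integrable setT (fun u : R => (F u * rlker c (u - v))%:E).
Proof.
move=> c1 v01; have c0 : 0 < c by exact: lt_le_trans c1.
have iG : mu.-integrable setT (fun u : R => ((Gamma c)^-1%R)%:E * ((EFin \o F)
  \_ `]v, 1%R[) u)%E.
  apply: integrableZl => //; apply/(integrable_mkcond _ _).1 => //.
  exact: iF.
apply: le_integrable iG => //.
  apply/measurable_EFinP/measurable_funM => //.
  apply: (measurableT_comp (@measurable_rlker R c)); exact: measurable_funB.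
move=> u _; rewrite patchE mem_setE in_itv /=.
have [vu|uv] := ltP v u; last first.
  by rewrite /rlker /pospow subr_gt0 ltNge uv !mulr0 normr0 mule0 abse0.
have [u1|u1] := ltP u 1; last by rewrite F1 // mul0r normr0 mule0 abse0.
rewrite -EFinM lee_fin /rlker mulrCA !normrM ler_wpM2l // ler_piMr //.
rewrite ger0_norm ?pospow_ge0 // /pospow subr_gt0 vu.
apply: (@le_trans _ _ (1 `^ (c - 1))); last by rewrite powR1.
have v0 : 0 < v by case/andP: v01.
apply: ge0_ler_powR; rewrite ?nnegrE ?subr_ge0 //; first exact: ltW.
by rewrite lerBlDr ltW // (lt_le_trans u1) // lerDl ltW.
Qed.

Let fracint_ge1 a (y : R) : 1 <= y -> fracint a F y = 0.
Proof.
move=> y1; rewrite /fracint /efracint integral0_eq // => u _.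
have [u1|u1] := ltP u 1; last by rewrite F1 // mul0r.
by rewrite /rlker /pospow subr_gt0 ltNge (le_trans (ltW u1)) // !mulr0.
Qed.

(** The bridge from [RLint], over []v, 1[], to the whole-line form: beyond 1 [fracint a F] vanishes,
    and below [v] the kernel does. So [h] matters on []0, 1[] only. *)
Lemma RLint_fracint a b (v : R) (h : R -> R) : 0 < a -> 0 < b -> 1 <= a + b ->
  0 < v < 1 -> (forall y, 0 < y < 1 -> h y = fracint a F y) ->
  RLint_cvg 1 b h v /\ RLint 1 b h v = fracint (a + b) F v.
Proof.
move=> a0 b0 ab1 v01 hE.
have Gb := Gamma_gt0 b0.
have iab := integrable_rlker ab1 v01.
have iJ := integrable_fracint_rlker mF a0 b0 iab.
pose k y := h y * (y - v) `^ (b - 1).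
have kE : (fun y => (k y)%:E) \_ `]v, 1[ =
    (fun y => (Gamma b)%:E * (fracint a F y * rlker b (y - v))%:E)%E.
  apply/funext => y; rewrite patchE mem_setE in_itv /= /k -EFinM.
  rewrite /rlker [in RHS]mulrCA [in RHS]mulVKf ?gt_eqF //.
  have [vy|yv] := ltP v y; last first.
    by rewrite /pospow subr_gt0 (ltNge v y) yv /= mulr0.
  have [y1|y1] := ltP y 1; last by rewrite fracint_ge1 // mul0r.
  rewrite hE ?y1 ?andbT; last by case/andP: v01 => v0 _; exact: lt_trans vy.
  by rewrite /= /pospow subr_gt0 vy.
split.
  rewrite /RLint_cvg; apply/(integrable_mkcond _ _).2 => //; rewrite kE.
  exact: integrableZl.
rewrite /RLint /Rintegral integral_mkcond.
rewrite [X in fine (integral _ _ X)]kE integralZl //.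
rewrite -(fracint_semigroup mF a0 b0 iab) /fracint [in RHS]/efracint.
have := integrable_fin_num measurableT iJ.
case: (integral _ _ _) => [r||] // _.
by rewrite -EFinM /= mulKf ?gt_eqF.
Qed.

(** Take second order 1 in the semigroup argument at the point [e]: the kernel [rlker 1 (y - e)] is
    1 on []e, 1[]. *)
Lemma integrable_fracint a (e : R) : 0 < a -> 0 < e < 1 ->
  mu.-integrable `]e, 1[ (EFin \o fracint a F).
Proof.
move=> a0 e01; have a1 : 1 <= a + 1 by rewrite lerDr ltW.
have iJ := integrable_fracint_rlker mF a0 ltr01 (integrable_rlker a1 e01).
have : mu.-integrable `]e, 1[ (fun y : R => (fracint a F y * rlker 1 (y -
  e))%:E).
  exact: integrableS iJ.
apply: eq_integrable => // y; rewrite inE /= in_itv /= => /andP[ey _].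
by rewrite rlker1 subr_gt0 ey mulr1.
Qed.

Let near01 (v : R) : 0 < v < 1 -> \forall y \near v, 0 < y < 1.
Proof.
move=> /andP[v0 v1]; near=> y; apply/andP; split; near: y.
  exact: lt_nbhsr.
exact: lt_nbhsl.
Unshelve. all: end_near. Qed.

Let near_fracintD1 a (v : R) : 0 < a -> 0 < v < 1 ->
  \forall y \near v, fracint 1 (fracint a F) y = fracint (a + 1) F y.
Proof.
move=> a0 v01; have a1 : 1 <= a + 1 by rewrite lerDr ltW.
apply: filterS (near01 v01) => y y01.
exact: fracint_semigroup mF a0 ltr01 (integrable_rlker a1 y01).
Qed.

Lemma continuous_fracint n (v : R) : 0 < v < 1 ->
  {for v, continuous (fracint n.+1%:R F)}.
Proof.
case: n => [|n] v01; first exact: continuous_fracint1.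
have n0 : 0 < n.+1%:R :> R by [].
have nv := near_fracintD1 n0 v01; rewrite natr1 in nv.
have /= nvv := nbhs_singleton nv.
rewrite /prop_for /continuous_at -nvv; apply: cvg_trans (near_eq_cvg nv) _.
apply: (continuous_fracint1 _ _ v01) => [u u1|e e01]; first exact: fracint_ge1.
exact: integrable_fracint.
Qed.

(** From order 2 on, the function is a primitive of a continuous one, so the derivative exists at
    every point. *)
Lemma is_derive_fracint n (v : R) : 0 < v < 1 ->
  is_derive v 1 (fracint n.+2%:R F) (- fracint n.+1%:R F v).
Proof.
move=> v01; have n0 : 0 < n.+1%:R :> R by [].
have nv := near_fracintD1 n0 v01; rewrite natr1 in nv.
apply: near_eq_is_derive nv _.
apply: continuous_is_derive_fracint1 => // [u u1|e e01|].
- exact: fracint_ge1.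
- exact: integrable_fracint.
- exact: continuous_fracint.
Qed.

Lemma ae_RLderiv_fracint a (h : R -> R) : 0 < a ->
  (forall y, 0 < y < 1 -> h y = fracint a F y) ->
  {ae mu, forall v : R, 0 < v < 1 ->
    RLderivable 1 a h v /\ RLderiv 1 a h v = F v}.
Proof.
(* The order [b] in [RLderiv] is what lifts [a] to the integer [m + 1]. *)
move=> a0 hE; pose m := Num.truncn a; pose b := 1 - (a - m%:R).
have /andP[ma am] : m%:R <= a < m.+1%:R by exact: truncn_itv (ltW a0).
have b0 : 0 < b by rewrite subr_gt0 ltrBlDl natr1.
have abE : a + b = m.+1%:R by rewrite /b -natr1; ring.
have ab1 : 1 <= a + b by rewrite abE ler1n.
pose G := RLint 1 b h.
have GE v : 0 < v < 1 -> G v = fracint m.+1%:R F v.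
  by move=> v01; rewrite -abE; exact: (RLint_fracint a0 b0 ab1 v01 hE).2.
pose D (g : R -> R) x := - derive1 g x.
have iterE i (v : R) : (i <= m)%N -> 0 < v < 1 ->
    iter i D G v = fracint (m - i).+1%:R F v.
  elim: i v => [|i IH] v im v01; first by rewrite subn0; exact: GE.
  have nv : \forall y \near v, fracint (m - i).+1%:R F y = iter i D G y.
    by apply: filterS (near01 v01) => y y01; rewrite IH // ltnW.
  rewrite iterS /D derive1E -(near_eq_derive _ nv) -(subnSK im).
  by have /@derive_val -> := is_derive_fracint (m - i.+1) v01; rewrite opprK.
have near_deriveE i (v : R) : 0 < v < 1 ->
    (forall y, 0 < y < 1 -> derive1n i G y = (-1) ^+ i * fracint (m - i).+1%:R F
      y) ->
    \forall y \near v, (-1) ^+ i * fracint (m - i).+1%:R F y = derive1n i G y.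
  by move=> v01 E; apply: filterS (near01 v01) => y y01; rewrite E.
(* [derivable_n] iterates [derive1] without the signs built into [RLderiv]; the powers of -1
   reconcile the two. *)
have deriveE i (v : R) : (i <= m)%N -> 0 < v < 1 ->
    derive1n i G v = (-1) ^+ i * fracint (m - i).+1%:R F v /\ derivable_n i G v.
  elim: i v => [|i IH] v im v01; first by rewrite subn0 mul1r; split=> //;
    exact: GE.
  have nv := near_deriveE i v v01 (fun y y01 => (IH y (ltnW im) y01).1).
  have dv : is_derive v 1 (derive1n i G) ((-1) ^+ i * - fracint (m - i.+1).+1%:R
    F v).
    apply: near_eq_is_derive nv _; rewrite -(subnSK im).
    have := is_derive_fracint (m - i.+1) v01.
    exact: is_deriveZ.
  split; first by rewrite derive1nS derive1E derive_val mulrN exprSr mulrN1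
    mulNr.
  split; last exact: ex_derive.
  by apply: filterS (near01 v01) => y y01; exact: (IH y (ltnW im) y01).2.
(* After [m] derivatives the order is 1; differentiating once more is the only step that costs a
   null set. *)
have := ae_is_derive_fracint1 F1 iF.
apply: filterS; first exact: (ae_filter_ringOfSetsType mu).
move=> v dv v01; have {}dv := dv v01.
split.
  split.
    apply: filterS (near01 v01) => y y01.
    by have [] := RLint_fracint a0 b0 ab1 y01 hE.
  split.
    by apply: filterS (near01 v01) => y y01; exact: (deriveE m y (leqnn m)
      y01).2.
  have nv := near_deriveE m v v01 (fun y y01 => (deriveE m y (leqnn m) y01).1).
  apply: (near_eq_derivable nv); rewrite subnn.
  by apply: ex_derive; exact: is_deriveZ.
have nv : \forall y \near v, fracint 1 F y = iter m D G y.
  by apply: filterS (near01 v01) => y y01; rewrite (iterE m y (leqnn m) y01)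
    subnn.
rewrite /RLderiv -/m iterS -/b -/G -/(D (iter m D G) v) /D derive1E.
by rewrite -(near_eq_derive _ nv) derive_val opprK.
Qed.

End RLderiv_fracint.

(** * Null sets and Borel representatives *)

Section null_modification.
Context d (T : measurableType d) (R : realType).
Variables (mu : {measure set T -> \bar R}) (N : set T).
Hypotheses (mN : measurable N) (N0 : mu N = 0%E).
Local Open Scope ereal_scope.

Import HBNNSimple.

(** A simple function below [f], set to 0 on [N], keeps its integral and lies below [g]. The
    supremum defining the integral needs no measurability of [f] or [g]. *)
Let ge0_integral_le_offnull (f g : T -> \bar R) :
  (forall x, 0 <= f x) -> (forall x, 0 <= g x) ->
  (forall x, ~ N x -> f x = g x) -> \int[mu]_x f x <= \int[mu]_x g x.
Proof.
move=> f0 g0 fg; rewrite ge0_integralTE //.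
apply: ge_ereal_sup => _ [h /= hf <-].
have mNC : measurable (~` N) by exact: measurableC.
rewrite -(@integralT_nnsfun _ _ _ mu h).
pose h' : {nnsfun T >-> R} := proj_nnsfun h mNC.
rewrite (_ : \int[mu]_x (h x)%:E = \int[mu]_x (h' x)%:E).
  rewrite [leRHS]ge0_integralTE // (@integralT_nnsfun _ _ _ mu h').
  apply: ereal_sup_ubound; exists h' => //= x.
  rewrite /= mindicE; have [Nx|Nx] := boolP (x \in ~` N); last by rewrite mulr0.
  by rewrite mulr1 -fg //; rewrite inE in Nx.
apply: ge0_ae_eq_integral => //.
- by apply/measurable_EFinP.
- by apply/measurable_EFinP.
- by move=> x _; rewrite lee_fin.
- by move=> x _; rewrite lee_fin.
exists N; split => // x /= /not_implyP[_ hh'].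
apply: contrapT => Nx; apply: hh'.
by rewrite /= mindicE mem_set // mulr1.
Qed.

(** Used to pass from [f0] to [g0] under the sphere integral, where the integrand with [f0] is not
    known to be measurable. *)
Lemma eq_integral_offnull (D : set T) (f g : T -> \bar R) :
  (forall x, D x -> ~ N x -> f x = g x) ->
  \int[mu]_(x in D) f x = \int[mu]_(x in D) g x.
Proof.
move=> fg; rewrite integral_mkcond [RHS]integral_mkcond.
have {}fg x : ~ N x -> (f \_ D) x = (g \_ D) x.
  by move=> Nx; rewrite !patchE; case: ifPn => // /set_mem Dx; exact: fg.
rewrite integralE [in RHS]integralE; congr (_ - _); apply/eqP; rewrite eq_le.
  by apply/andP; split; apply: ge0_integral_le_offnull => // x Nx;
    rewrite !funeposE fg.
by apply/andP; split; apply: ge0_integral_le_offnull => // x Nx;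
  rewrite !funenegE fg.
Qed.

End null_modification.

Section sphere_section.
Context {R : realType}.
Local Notation mu := (@lebesgue_measure R).
Local Notation T k := (k.-tuple (measurableTypeR R)).
Local Open Scope ereal_scope.

Let pospow_diff a (c : R) :
  (pospow a (1 - c) * pospow a (1 + c) = pospow a (1 - c ^+ 2))%R.
Proof.
have -> : (1 - c ^+ 2 = (1 - c) * (1 + c))%R by ring.
have [c1|c1] := ltP c 1%R; first by rewrite pospowM ?subr_gt0 // {1}/pospow
  subr_gt0 c1.
rewrite /pospow subr_gt0 ltNge c1 mul0r ltNge mulr_le0_ge0 ?subr_le0 //.
by rewrite addr_ge0 // (le_trans _ c1).
Qed.

(** Put [u = 1 - l (1 - c)] with [l = (1 - v) / 2]: then [1 - u = l (1 - c)] and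
    [u - v = l (1 + c)], whose product is [l^2 (1 - c^2)]. With the Jacobian [l] the power is
    [2 a - 1], that is [k - 2] for [a = (k - 1) / 2]. *)
Lemma ge0_integral_cap (g : R -> \bar R) a (v : R) :
  measurable_fun setT g -> (forall x, 0 <= g x) -> (0 < a)%R -> (v < 1)%R ->
  \int[mu]_u (g u * (pospow (a - 1) (1 - u) * rlker a (u - v))%:E) =
  (((1 - v) / 2) `^ (2 * a - 1))%:E *
  \int[mu]_c (g (1 - (1 - v) / 2 * (1 - c))%R * (rlker a (1 - c ^+ 2))%:E).
Proof.
move=> mg g0 a0 v1; pose l : R := ((1 - v) / 2)%R.
have l0 : (0 < l)%R by rewrite divr_gt0 // subr_gt0.
pose f u := g u * (pospow (a - 1) (1 - u) * rlker a (u - v))%:E.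
have mf : measurable_fun setT f.
  apply: emeasurable_funM => //; apply/measurable_EFinP/measurable_funM.
    apply: (measurableT_comp (measurable_pospow _)); exact: measurable_funB.
  apply: (measurableT_comp (@measurable_rlker R a)); exact: measurable_funB.
have f0 u : 0 <= f u.
  by rewrite mule_ge0 // lee_fin mulr_ge0 ?pospow_ge0 // rlker_ge0.
rewrite -[LHS]/(\int[mu]_u f u).
rewrite (ge0_integral_affine (1 - l)%R (lt0r_neq0 l0) mf f0) (gtr0_norm l0).
rewrite -/l.
have mh : measurable_fun setT (fun c : R =>
    g (1 - l * (1 - c))%R * (rlker a (1 - c ^+ 2))%:E).
  apply: emeasurable_funM.
    apply: measurableT_comp mg _; apply: measurable_funB => //.
    by apply: measurable_funM => //; exact: measurable_funB.
  apply/measurable_EFinP; apply: (measurableT_comp (@measurable_rlker R a)).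
  by apply: measurable_funB => //; exact: exprn_measurable.
transitivity (l%:E * \int[mu]_c ((l `^ (2 * a - 2))%:E *
    (g (1 - l * (1 - c))%R * (rlker a (1 - c ^+ 2))%:E))).
  congr (_ * _); apply: eq_integral => c _; rewrite /f muleCA.
  have -> : (l * c + (1 - l) = 1 - l * (1 - c))%R by ring.
  congr (_ * _); rewrite -EFinM; congr EFin.
  have -> : (1 - (1 - l * (1 - c)) = l * (1 - c))%R by ring.
  have -> : (1 - l * (1 - c) - v = l * (1 + c))%R by rewrite /l; field.
  rewrite /rlker !pospowM // -pospow_diff.
  have -> : (2 * a - 2 = (a - 1) + (a - 1))%R by ring.
  by rewrite (@powRD _ l (a - 1) (a - 1)) ?(gt_eqF l0) ?implybT //; ring.
rewrite ge0_integralZl; last 4 first.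
- by [].
- exact: mh.
- by move=> c _; rewrite mule_ge0 // lee_fin rlker_ge0.
- by rewrite lee_fin powR_ge0.
rewrite muleA -EFinM; congr (_%:E * _).
have -> : (2 * a - 2 = 2 * a - 1 - 1)%R by ring.
by rewrite -{1}(powRr1 (ltW l0)) -powRD ?(gt_eqF l0) ?implybT //;
  congr (_ `^ _)%R; ring.
Qed.

(** The density of the image of surface measure under [t |-> 1 - (1 - v) / 2 * (1 - tdot e t)], for
    a unit vector [e]. *)
Definition cap_kernel k (v u : R) : R :=
  (2 * Num.sqrt pi ^+ k.-1 * ((1 - v) / 2) ^- (k - 2) *
   (pospow ((k%:R - 1) / 2 - 1) (1 - u) * rlker ((k%:R - 1) / 2) (u - v)))%R.

Section cap.
Variables (k : nat) (e : T k) (v : R).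
Hypotheses (k2 : (1 < k)%N) (e1 : sqnorm e = 1%R) (v1 : (v < 1)%R).

Let a0 : (0 < (k%:R - 1) / 2 :> R)%R.
Proof. by rewrite divr_gt0 // subr_gt0 ltr1n. Qed.

Lemma cap_kernel_ge0 u : (0 <= cap_kernel k v u)%R.
Proof.
apply: mulr_ge0; last by rewrite mulr_ge0 ?pospow_ge0 // rlker_ge0.
apply: mulr_ge0; first by rewrite mulr_ge0 ?exprn_ge0 ?sqrtr_ge0.
by rewrite invr_ge0 exprn_ge0 // divr_ge0 // subr_ge0 ltW.
Qed.

Lemma measurable_cap_kernel : measurable_fun setT (cap_kernel k v).
Proof.
apply: measurable_funM => //; apply: measurable_funM.
  apply: (measurableT_comp (measurable_pospow _)); exact: measurable_funB.
apply: (measurableT_comp (@measurable_rlker R _)); exact: measurable_funB.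
Qed.

Lemma ge0_integral_sphere_cap (g : R -> \bar R) :
  measurable_fun setT g -> (forall x, 0 <= g x) ->
  \int[@sphere_measure R k]_(t in @unit_sphere R k)
    g (1 - (1 - v) / 2 * (1 - tdot e t))%R =
  \int[mu]_u (g u * (cap_kernel k v u)%:E).
Proof.
move=> mg g0; have l0 : (0 < (1 - v) / 2)%R by rewrite divr_gt0 // subr_gt0.
have mg' : measurable_fun setT (fun x : R => g (1 - (1 - v) / 2 * (1 - x))%R).
  apply: measurableT_comp mg _; apply: measurable_funB => //.
  by apply: measurable_funM => //; exact: measurable_funB.
have sphereE : \int[@sphere_measure R k]_(t in @unit_sphere R k)
    g (1 - (1 - v) / 2 * (1 - tdot e t))%R =
  (2 * Num.sqrt pi ^+ k.-1)%:E * \int[mu]_c (g (1 - (1 - v) / 2 * (1 - c))%R *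
    (rlker ((k%:R - 1) / 2) (1 - c ^+ 2))%:E).
  case: k k2 e e1 => [|[|n]] // _ e' e1'.
  rewrite (ge0_integral_sphere_tdot mg' (fun x => g0 _) e1').
  by rewrite -[in n.+2%:R]natr1 addrK.
rewrite sphereE.
have := ge0_integral_cap mg g0 a0 v1.
have -> : (2 * ((k%:R - 1) / 2) - 1 = (k - 2)%:R :> R)%R.
  by rewrite natrB //; field.
rewrite powR_mulrn ?(ltW l0) // => capE.
have ln0 : (((1 - v) / 2) ^+ (k - 2) != 0)%R by rewrite expf_neq0 // gt_eqF.
have := congr1 (fun x => ((((1 - v) / 2) ^+ (k - 2))^-1)%:E * x) capE.
rewrite [RHS]muleA -[X in _ = X * _]EFinM mulVf // mul1e => <-.
rewrite muleA -EFinM -ge0_integralZl; last 4 first.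
- by [].
- apply: emeasurable_funM => //; apply/measurable_EFinP/measurable_funM.
    apply: (measurableT_comp (measurable_pospow _)); exact: measurable_funB.
  apply: (measurableT_comp (@measurable_rlker R _)); exact: measurable_funB.
- by move=> u _; rewrite mule_ge0 // lee_fin mulr_ge0 ?pospow_ge0 // rlker_ge0.
- rewrite lee_fin; apply: mulr_ge0.
    by rewrite mulr_ge0 ?exprn_ge0 ?sqrtr_ge0.
  by rewrite invr_ge0 exprn_ge0 ?(ltW l0).
by apply: eq_integral => u _; rewrite muleCA -EFinM.
Qed.

(** Positive and negative parts are transformed separately, so the equality persists when either
    integral diverges. *)
Lemma integral_sphere_cap (q : R -> R) : measurable_fun setT q ->
  \int[@sphere_measure R k]_(t in @unit_sphere R k)
    (q (1 - (1 - v) / 2 * (1 - tdot e t)))%:E =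
  \int[mu]_u (q u * cap_kernel k v u)%:E.
Proof.
move=> mq; rewrite integralE [in RHS]integralE.
have mqE : measurable_fun setT (EFin \o q) by exact/measurable_EFinP.
congr (_ - _).
  transitivity (\int[mu]_u ((EFin \o q)^\+ u * (cap_kernel k v u)%:E)).
    rewrite -ge0_integral_sphere_cap //; last exact: measurable_funepos.
    by apply: eq_integral => t _; rewrite !funeposE.
  apply: eq_integral => u _; rewrite !funeposE /=.
  by rewrite -!EFin_max -EFinM maxr_pMl ?cap_kernel_ge0 // mul0r.
transitivity (\int[mu]_u ((EFin \o q)^\- u * (cap_kernel k v u)%:E)).
  rewrite -ge0_integral_sphere_cap //; last exact: measurable_funeneg.
  by apply: eq_integral => t _; rewrite !funenegE.
apply: eq_integral => u _; rewrite !funenegE /=.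
by rewrite -!EFin_max -EFinM maxr_pMl ?cap_kernel_ge0 // mul0r mulNr.
Qed.

End cap.

End sphere_section.

Section borel_representative.
Context {R : realType}.
Local Notation mu := (@lebesgue_measure R).
Local Notation cmu := (@completed_lebesgue_measure R).

Let completed_measurable_borel (S : set R) :
  (wlength (@idfun R))^*%mu.-cara.-measurable S ->
  exists B M : set R, [/\ measurable B, measurable M, mu M = 0%E &
    S `\` M = B `\` M].
Proof.
rewrite -completed_caratheodory_measurable g_sigma_completed_algebra_genE.
move=> [B mB [N [M [mM M0 NM]]] <-]; exists B, M; split => //.
apply/seteqP; split => x [] ; last by move=> Bx Mx; split => //; left.
by move=> [Bx|/NM] // Mx.
Qed.

(** Each set [f > q] with [q] rational is Borel up to a null set; one null set serves all [q], and
    off it every [f > r] is a countable union of Borel sets. *)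
Lemma completed_integrable_borel (A : set R) (f : R -> R) :
  measurable A -> cmu.-integrable A (EFin \o f) ->
  exists N : set R, [/\ measurable N, mu N = 0%E,
    measurable_fun (A `\` N : set (measurableTypeR R)) f &
    mu.-integrable (A `\` N) (EFin \o f)].
Proof.
move=> mA intf; have /integrableP[mf foo] := intf.
have mcA : (wlength (@idfun R))^*%mu.-cara.-measurable A.
  exact: sub_caratheodory.
have mS (q : rat) : (wlength (@idfun R))^*%mu.-cara.-measurable
    (A `&` [set x | ((ratr q)%:E < (f x)%:E)%E]).
  exact: (emeasurable_fun_o_infty mcA mf).
have [B BP] := choice (fun q => completed_measurable_borel (mS q)).
have [M MP] := choice BP.
pose N := \bigcup_n oapp M set0 (unpickle n).
have NE q : M q `<=` N.
  by move=> x Mx; exists (pickle q); [exact: I | rewrite pickleK; exact: Mx].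
have mN : measurable N.
  apply: bigcup_measurable => n _; case: (unpickle n) => [q|] //=.
  by case: (MP q).
have N0 : mu N = 0%E.
  apply: measure_negligible => //; apply: negligible_bigcup => n.
  case: (unpickle n) => [q|] /=; last exact: negligible_set0.
  by case: (MP q) => _ mM M0 _; apply/negligibleP.
have mAN : measurable (A `\` N : set (measurableTypeR R)) by exact: measurableD.
have mfN : measurable_fun (A `\` N : set (measurableTypeR R)) f.
  apply: (measurability _ (RGenOInfty.measurableE R)).
  move=> _ [_ [r ->] <-].
  rewrite (_ : _ `&` _ = \bigcup_(q in [set q : rat | r < ratr q]) (B q `\` N)).
    rewrite bigcup_mkcond; apply: bigcupT_measurable_rat => q.
    case: ifPn => _; last exact: measurable0.
    by apply: measurableD => //; case: (MP q).
  apply/seteqP; split => x.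
    move=> [[Ax Nx]]; rewrite /= in_itv /= andbT => /rat_in_itvoo[q].
    rewrite in_itv /= => /andP[rq qf].
    exists q => //; split => //.
    have : (B q `\` M q) x.
      have [_ _ _ <-] := MP q; split=> [|/NE //].
      by split => //=; rewrite lte_fin.
    by case.
  move=> [q /= rq [Bx Nx]].
  have [_ _ _ SE] := MP q.
  have : (B q `\` M q) x by split => // /NE.
  rewrite -SE => -[[Ax /= qf] _]; split => //=.
  by rewrite in_itv /= andbT (lt_trans rq).
exists N; split => //; apply/integrableP; split; first exact/measurable_EFinP.
apply: le_lt_trans foo.
(* The identity from the completed to the Borel sigma-algebra carries one measure to the other, so
   the integrals can be compared by an image-measure formula. *)
pose idc : caratheodory_type (wlength (@idfun R))^*%mu -> measurableTypeR R :=
  id.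
have midc : measurable_fun setT idc.
  by move=> _ X mX; rewrite setTI; exact: sub_caratheodory.
pose cmuid : {measure set (measurableTypeR R) -> \bar R} :=
  measure_function_pushforward__canonical__measure_function_Measure cmu midc.
have -> : (\int[mu]_(x in A `\` N) `|(EFin \o f) x| =
    \int[cmuid]_(x in A `\` N) `|(EFin \o f) x|)%E.
  exact: eq_measure_integral.
have mabs : measurable_fun (A `\` N : set (measurableTypeR R))
    (fun x => `|(EFin \o f) x|)%E.
  by apply: measurableT_comp => //; exact/measurable_EFinP.
rewrite (ge0_integral_pushforward midc) //.
apply: ge0_subset_integral => //.
- by have := midc measurableT _ mAN; rewrite setTI.
- exact: (measurableT_comp (@abse_measurable R setT) mf).
- by move=> x _; exact: abse_ge0.
- by move=> x [].
Qed.

End borel_representative.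

Section square_substitution.
Context {R : realType}.
Local Notation mu := (@lebesgue_measure R).

Lemma negligible_preimage_sqr (N : set R) : measurable N -> mu N = 0%E ->
  mu [set s | N (s ^+ 2)] = 0%E.
Proof.
move=> mN N0.
have mE : measurable [set s : R | N (s ^+ 2)].
  have msqr : measurable_fun setT (fun x : R => x ^+ 2) by exact:
    exprn_measurable.
  by rewrite -[X in measurable X]setTI; exact: msqr.
have mI : measurable_fun setT (fun u : R => (\1_N u : R)%:E).
  by apply/measurable_EFinP; exact: measurable_indic.
have I0 u : (0 <= (\1_N u : R)%:E)%E by rewrite lee_fin.
have := ge0_integral_sqr mI I0.
rewrite [RHS](_ : _ = 0)%E.
  rewrite -[X in X = _ -> _](_ : (\int[mu]_x (\1_[set s : R | N (s ^+ 2)]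
    x)%:E)%E = _) //.
  by rewrite integral_indic // setIT.
rewrite (ae_eq_integral (cst 0%E)) ?integral0 //.
  apply: emeasurable_funM => //; apply/measurable_EFinP;
    exact: measurable_pospow.
exists N; split => // u /= /not_implyP[_ h]; apply: contrapT => Nu; apply: h.
by rewrite indicE memNset // mul0e.
Qed.

Lemma negligible_preimage_sqrt (N : set R) : measurable N -> mu N = 0%E ->
  mu [set u | 0 < u /\ N (Num.sqrt u)] = 0%E.
Proof.
move=> mN N0.
have mE : measurable [set u : R | 0 < u /\ N (Num.sqrt u)].
  rewrite (_ : [set u : R | _] = `]0, +oo[%classic `&` (setT `&` Num.sqrt @^-1`
    N)).
    apply: measurableI => //.
    exact: (continuous_measurable_fun (@sqrt_continuous R)).
  by rewrite setTI; apply/seteqP; split => u /=; rewrite in_itv /= andbT.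
set E := [set u | _] in mE *.
(* The factor [u^(1/2)] cancels the density [u^(-1/2)] of squaring, which turns the measure of [E]
   into an integral of [f (x^2)]; that integrand vanishes unless [|x|] lies in [N]. *)
pose f u : \bar R := (\1_E u * pospow 2^-1 u)%:E.
have mf : measurable_fun setT f.
  apply/measurable_EFinP/measurable_funM; first exact: measurable_indic.
  exact: measurable_pospow.
have f0 u : (0 <= f u)%E by rewrite lee_fin mulr_ge0 ?pospow_ge0.
have -> : mu E = (\int[mu]_u (f u * (pospow (- 2^-1) u)%:E))%E.
  rewrite -[E in LHS]setIT -integral_indic //; apply: eq_integral => u _.
  rewrite /f -EFinM -mulrA -pospowD subrr; congr EFin.
  rewrite indicE; have [/set_mem[u0 _]|] := boolP (u \in E);
    last by rewrite mul0r.
  by rewrite /pospow u0 powRr0 mulr1.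
rewrite -(ge0_integral_sqr mf f0).
have mNN : measurable (-%R @^-1` N : set R).
  rewrite -[X in measurable X]setTI; exact: (@oppr_measurable R setT).
have NN0 : mu (-%R @^-1` N) = 0%E by have := lebesgue_measureN mN; rewrite N0.
rewrite (ae_eq_integral (cst 0%E)) ?integral0 //.
  apply: measurableT_comp mf _; exact: exprn_measurable.
exists (N `|` -%R @^-1` N); split.
- exact: measurableU.
- by apply: measure_negligible; [exact: measurableU|];
    apply: negligibleU; exact/negligibleP.
move=> x /= /not_implyP[_ h]; apply: contrapT => /not_orP[Nx NNx]; apply: h.
rewrite /f indicE memNset ?mul0r // => -[_]; rewrite sqrtr_sqr.
by have [x0|x0] := leP 0 x; [rewrite ger0_norm | rewrite ltr0_norm].
Qed.

Lemma integrable_sqrt_subst (g : R -> R) (e : R) : 0 < e < 1 ->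
  measurable_fun setT g ->
  mu.-integrable `]Num.sqrt e, 1[ (fun s => (g s * s)%:E) ->
  mu.-integrable `]e, 1[ (fun u => (g (Num.sqrt u))%:E).
Proof.
move=> /andP[e0 e1] mg /integrableP[_ goo].
have msqrt : measurable_fun setT (@Num.sqrt R).
  exact: (continuous_measurable_fun (@sqrt_continuous R)).
have mgs : measurable_fun setT (fun u : R => g (Num.sqrt u)).
  exact: measurableT_comp mg msqrt.
apply/integrableP; split; first exact/measurable_funTS/measurable_EFinP.
pose f u : \bar R := ((`|g (Num.sqrt u)| * \1_(`]e, 1[) u) * pospow 2^-1 u)%:E.
have mf : measurable_fun setT f.
  apply/measurable_EFinP/measurable_funM; last exact: measurable_pospow.
  apply: measurable_funM; last exact: measurable_indic.
  exact: measurableT_comp.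
have f0 u : (0 <= f u)%E by rewrite lee_fin !mulr_ge0 ?pospow_ge0.
pose q x : \bar R := ((fun s => `|(g s * s)%:E|%E) \_ `]Num.sqrt e, 1[) x.
have mq : measurable_fun setT q.
  apply: (measurable_restrictT _ _).1 => //; apply: measurable_funTS.
  apply: measurableT_comp => //; apply/measurable_EFinP; exact: measurable_funM.
have q0 x : (0 <= q x)%E by rewrite /q patchE; case: ifP.
have -> : (\int[mu]_(u in `]e, 1%R[) `|(g (Num.sqrt u))%:E| =
    \int[mu]_u (f u * (pospow (- 2^-1) u)%:E))%E.
  rewrite integral_mkcond; apply: eq_integral => u _.
  rewrite patchE mem_setE /f -EFinM -!mulrA -pospowD addrN indicE mem_setE
    in_itv /=.
  have [/andP[eu u1]|_] := boolP (e < u < 1); last by rewrite mul0r mulr0.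
  by rewrite /pospow (lt_trans e0 eu) powRr0 !mulr1.
rewrite -(ge0_integral_sqr mf f0).
have N10 : - 1 != 0 :> R by rewrite oppr_eq0 oner_neq0.
(* Squaring folds the line, so each sign of [x] contributes one copy: this is the 2 in
   [du = 2 s ds]. *)
have -> : (\int[mu]_x f (x ^+ 2)%R = \int[mu]_x (q x + q (- x)%R))%E.
  have se : (Num.sqrt e) ^+ 2 = e by rewrite sqr_sqrtr // ltW.
  have fE x : 0 <= x -> f (x ^+ 2) = q x.
    move=> x0; rewrite /f /q patchE indicE !mem_setE !in_itv /= sqrtr_sqr
      (ger0_norm x0).
    rewrite -[e in e < _]se ltr_pXn2r ?nnegrE ?sqrtr_ge0 //.
    rewrite expr_lt1 //.
    case: ifPn => [/andP[ex _]|_]; last by rewrite mulr0 mul0r.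
    have xgt0 : 0 < x by rewrite (le_lt_trans (sqrtr_ge0 e)).
    rewrite mulr1 normrM (ger0_norm x0) /pospow exprn_gt0 //.
    by rewrite powR12_sqrt ?sqr_ge0 // sqrtr_sqr (ger0_norm x0).
  have q_le0 x : x <= 0 -> q x = 0%E.
    move=> x0; rewrite /q patchE mem_setE in_itv /= ltNge.
    by rewrite (le_trans x0 (sqrtr_ge0 _)).
  apply: eq_integral => x _; have [x0|x0] := leP 0 x.
    by rewrite fE // [X in (_ + X)%E]q_le0 ?adde0 // oppr_le0.
  by rewrite -sqrrN fE ?oppr_ge0 ?(ltW x0) // (q_le0 x (ltW x0)) add0e.
rewrite ge0_integralD //; last by apply: measurableT_comp => //.
have <- : (\int[mu]_x q x = \int[mu]_x q (- x)%R)%E.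
  rewrite [LHS](ge0_integral_affine 0 N10 mq q0) normrN1 mul1e.
  by apply: eq_integral => x _; rewrite mulN1r addr0.
have : (\int[mu]_x q x < +oo)%E by rewrite /q -integral_mkcond.
by move=> qoo; rewrite lte_add_pinfty.
Qed.

End square_substitution.

Section radial_representative.
Context {R : realType}.
Local Notation mu := (@lebesgue_measure R).

Lemma borel_representative (f0 : R -> R) (c : R) :
  (forall e : R, 0 < e < 1 ->
    (@completed_lebesgue_measure R).-integrable `]e, 1[
      (fun s : R => (f0 s * (1 - s ^+ 2) `^ c * s)%:E)) ->
  exists N (g0 : R -> R),
  [/\ measurable N, mu N = 0%E, measurable_fun setT g0,
      (forall s, ~~ (0 < s < 1) -> g0 s = 0) &
      (forall s, 0 < s < 1 -> ~ N s -> f0 s = g0 s)] /\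
      (forall e, 0 < e < 1 -> mu.-integrable `]e, 1[
        (fun s => (g0 s * (1 - s ^+ 2) `^ c * s)%:E)).
Proof.
move=> hf0; pose p s := f0 s * (1 - s ^+ 2) `^ c * s.
pose e (n : nat) : R := n.+2%:R^-1.
have e01 n : 0 < e n < 1 by rewrite invr_gt0 ltr0n invf_lt1 // ltr1n.
have e_lt x : 0 < x -> exists n, e n < x.
  move=> x0; exists (Num.bound x^-1); rewrite /e invf_plt ?posrE //.
  by rewrite (lt_trans (archi_boundP _)) ?invr_ge0 ?(ltW x0) // ltr_nat.
have mI n : measurable (`]e n, 1[%classic : set (measurableTypeR R)) by [].
have [M MP] := choice (fun n =>
  completed_integrable_borel (mI n) (hf0 _ (e01 n))).
pose N := \bigcup_n M n.
have mM n : measurable (M n) by case: (MP n).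
have mN : measurable N by exact: bigcupT_measurable.
have N0 : mu N = 0%E.
  apply: measure_negligible => //; apply: negligible_bigcup => n.
  by apply/negligibleP => //; case: (MP n).
have NM n : M n `<=` N by move=> x Mx; exists n.
pose D := `]0, 1[%classic `\` N.
have mD : measurable D by exact: measurableD.
have DE : D = \bigcup_n (`]e n, 1[%classic `\` N).
  apply/seteqP; split => s.
    move=> [] /=; rewrite in_itv /= => /andP[s0 s1] Ns.
    by have [n ns] := e_lt _ s0; exists n => //; split => //=;
      rewrite in_itv /= ns.
  move=> [n _ [/=]]; rewrite in_itv /= => /andP[ns s1] Ns; split => //=.
  by rewrite in_itv /= s1 andbT (lt_trans (andP (e01 n)).1 ns).
have mp : measurable_fun (D : set (measurableTypeR R)) p.
  rewrite DE; apply/measurable_fun_bigcup => n; first exact: measurableD.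
  have [_ _ mp _] := MP n; apply: measurable_funS mp.
    exact: (measurableD (mI n) (mM n)).
  by move=> s [sn Ns]; split => // /NM.
(* Only the weighted function [p] is known to be Borel on [D]; dividing by the weight, positive on
   []0, 1[], recovers [f0] there. *)
pose g0 := (fun s => p s * (s `^ (- 1) * (1 - s ^+ 2) `^ (- c))) \_ D.
have g0E s : 0 < s < 1 -> ~ N s -> f0 s = g0 s.
  move=> /andP[s0 s1] Ns; rewrite /g0 patchE mem_set; last first.
    by split => //=; rewrite in_itv /= s0.
  have w0 : 0 < 1 - s ^+ 2 by rewrite subr_gt0 expr_lt1 // ltW.
  rewrite /p powR_inv1 ?(ltW s0) // powRN; field.
  by rewrite !gt_eqF // powR_gt0.
have g00 s : ~~ (0 < s < 1) -> g0 s = 0.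
  move=> s01; rewrite /g0 patchE memNset // => -[/=].
  by rewrite in_itv /= (negbTE s01).
have mw a : measurable_fun setT (fun s : R => (1 - s ^+ 2) `^ a).
  have m1 : measurable_fun setT (fun s : R => 1 - s ^+ 2).
    by apply: measurable_funB => //; exact: exprn_measurable.
  exact: (measurableT_comp (measurable_powR _) m1).
have mg0 : measurable_fun setT g0.
  apply: (measurable_restrictT _ mD).1; apply: measurable_funM => //.
  apply: measurable_funTS; apply: measurable_funM; first exact: measurable_powR.
  exact: mw.
exists N, g0; split; first by split.
move=> d /andP[d0 d1]; have [n nd] := e_lt _ d0.
have mq : measurable_fun (`]d, 1[%classic : set (measurableTypeR R))
    (fun s => (g0 s * (1 - s ^+ 2) `^ c * s)%:E).
  apply: measurable_funTS; apply/measurable_EFinP.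
  apply: measurable_funM => //; apply: measurable_funM => //.
  exact: mw.
have md : measurable (`]d, 1[%classic : set (measurableTypeR R)) by [].
apply: (@negligible_integrable _ (measurableTypeR R) R mu _ N _ mN md mq N0).2.
have [_ _ _ ip] := MP n.
have : mu.-integrable (`]d, 1[ `\` N) (EFin \o p).
  apply: integrableS ip; [exact: (measurableD (mI n) (mM n))|exact:
    measurableD|].
  move=> s [/=]; rewrite in_itv /= => /andP[ds s1] Ns; split; last by move/NM.
  by rewrite /= in_itv /= s1 (lt_trans nd).
apply: eq_integrable; first exact: measurableD.
move=> s; rewrite inE /= in_itv /= => -[/andP[ds s1] Ns].
by rewrite /p g0E // s1 andbT (lt_trans d0).
Qed.

End radial_representative.

(** * Radial functions *)

Section coordinates.
Context {R : realType} {n : nat}.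
Variable xi : {vspace 'rV[R]_n}.
Local Notation T := ((\dim xi).-tuple (measurableTypeR R)).

Let basis_span : span (orthonormal_basis xi) = xi.
Proof.
by rewrite /orthonormal_basis; case: cid => e /= [/span_basis].
Qed.

Let basis_orthonormal : orthonormal_seq (orthonormal_basis xi).
Proof. by rewrite /orthonormal_basis; case: cid => e /= []. Qed.

Lemma dotv_of_coord (c d : T) : dotv (of_coord c) (of_coord d) = tdot c d.
Proof.
rewrite dotv_suml /tdot; apply: eq_bigr => i _.
rewrite dotvZl; congr (_ * _); rewrite dotvC dotv_suml (bigD1 i) //= big1.
  by rewrite dotvZl basis_orthonormal ?size_tuple // eqxx mulr1 addr0.
move=> j ji; rewrite dotvZl basis_orthonormal ?size_tuple //.
by rewrite (_ : _ == _ = false) ?mulr0 //; apply/negbTE.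
Qed.

Lemma of_coord_surj x : x \in xi -> exists c : T, x = of_coord c.
Proof.
rewrite -{1}basis_span => /coord_span xE.
exists [tuple coord (orthonormal_basis xi) i x | i < \dim xi].
by rewrite {1}xE; apply: eq_bigr => i _; rewrite tnth_mktuple.
Qed.

Lemma of_coordD (c d : T) (s : R) :
  of_coord c + s *: of_coord d =
  of_coord ([tuple tnth c i + s * tnth d i | i < \dim xi] : T).
Proof.
rewrite /of_coord scaler_sumr -big_split; apply: eq_bigr => i _ /=.
by rewrite tnth_mktuple scalerDl scalerA.
Qed.

Lemma sqnormD k (c d : k.-tuple (measurableTypeR R)) (s : R) :
  sqnorm ([tuple tnth c i + s * tnth d i | i < k] : k.-tuple (measurableTypeR
    R)) =
  sqnorm c + 2 * s * tdot c d + s ^+ 2 * sqnorm d.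
Proof.
rewrite /sqnorm /tdot !mulr_sumr -!big_split; apply: eq_bigr => i _ /=.
by rewrite tnth_mktuple; ring.
Qed.

(* [e] is [x / |x|] in coordinates, and [tdot e c] the height of [c] over it. *)
Lemma enorm_cap x : x \in xi -> 0 < enorm x < 1 ->
  exists2 e : T, sqnorm e = 1 &
  forall c : T, sqnorm c = 1 ->
    enorm (x + (1 - enorm x) *: of_coord c) =
    Num.sqrt (1 - (1 - `|2 * enorm x - 1| ^+ 2) / 2 * (1 - tdot e c)).
Proof.
move=> /of_coord_surj[d dE] /andP[r0 r1]; set r := enorm x in r0 r1 *.
have sd : sqnorm d = r ^+ 2.
  have -> : sqnorm d = dotv x x.
    by rewrite dE dotv_of_coord; apply: eq_bigr => i _; rewrite expr2.
  rewrite sqr_sqrtr //; apply: sumr_ge0 => i _; rewrite -expr2; exact: sqr_ge0.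
exists [tuple r^-1 * tnth d i | i < \dim xi].
  by rewrite sqnorm_scale sd exprVn mulVf // expf_neq0 // gt_eqF.
move=> c c1; rewrite {1}dE of_coordD /enorm dotv_of_coord; congr Num.sqrt.
set z := (X in tdot X X); have -> : tdot z z = sqnorm z.
  by apply: eq_bigr => i _; rewrite expr2.
(* With height [h] the square is [r^2 + 2 r (1 - r) h + (1 - r)^2 = 1 - 2 r (1 - r) (1 - h)], and
   [(1 - (2 r - 1)^2) / 2 = 2 r (1 - r)]. *)
rewrite sqnormD sd c1 tdot_scale real_normK ?num_real //.
by field; rewrite gt_eqF.
Qed.

End coordinates.

(** A profile is constrained only at values of [t] that occur; all of []0, 1[] do, so [Phi] is
    determined there. *)
Lemma exists_profile_point (R : realType) (n k : nat) (t : R) :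
  (0 < k <= n)%N -> 0 < t < 1 ->
  exists (x : 'rV[R]_n) xi, [/\ 0 < enorm x < 1, grass_through k x xi &
    `|2 * enorm x - 1| = t].
Proof.
move=> /andP[k0 kn] /andP[t0 t1].
pose B := vbasis {: 'rV[R]_n}.
have sB : size B = n by rewrite size_tuple dimvf /dim /= mul1n.
have fB : free (take k B).
  have := basis_free (vbasisP {: 'rV[R]_n}); rewrite -/B => fB.
  by apply: (@catl_free _ _ (drop k B)); rewrite cat_take_drop.
have skB : size (take k B) = k by rewrite size_takel // sB.
pose b := head 0 (take k B).
have bB : b \in take k B.
  by rewrite /b; case: (take k B) skB => [|h s] //=;
    [case: (k) k0|rewrite mem_head].
have b0 : b != 0 by exact: free_not0 bB.
have nb0 : 0 < enorm b by rewrite sqrtr_gt0 dotv_gt0.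
(* Of the two radii with [|2 r - 1| = t], the larger one. *)
pose r := (1 + t) / 2.
have r0 : 0 < r by rewrite divr_gt0 // addr_gt0.
have nx : enorm ((r / enorm b) *: b) = r.
  rewrite {1}/enorm dotvZl dotvC dotvZl mulrA -expr2.
  rewrite sqrtrM ?sqr_ge0 // sqrtr_sqr -/(enorm b) ger0_norm ?divfK ?gt_eqF //.
  by rewrite divr_ge0 // ltW.
exists ((r / enorm b) *: b), (span (take k B)); split.
- rewrite nx r0 /= /r ltr_pdivrMr //; lra.
- split; first by rewrite -[RHS]skB; exact/eqP.
  by apply/memvZ/memv_span.
- rewrite nx /r ger0_norm; first by field.
  by rewrite mulrC divfK // addrAC subrr add0r ltW.
Qed.

(** * The transform of a radial function as a fractional integral *)

Section Qplus_as_fractional_integral.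
Context {R : realType}.
Local Notation mu := (@lebesgue_measure R).
Variables (f0 g0 : R -> R) (N : set R).
Hypotheses (mN : measurable N) (N0 : mu N = 0%E) (mg0 : measurable_fun setT g0).
Hypothesis g00 : forall s, ~~ (0 < s < 1) -> g0 s = 0.
Hypothesis g0E : forall s, 0 < s < 1 -> ~ N s -> f0 s = g0 s.

Let msqrt : measurable_fun setT (@Num.sqrt R).
Proof. exact: (continuous_measurable_fun (@sqrt_continuous R)). Qed.

Definition radial_density (a u : R) : R := g0 (Num.sqrt u) * pospow (a - 1) (1 -
  u).

Lemma measurable_radial_density a : measurable_fun setT (radial_density a).
Proof.
apply: measurable_funM; first exact: measurableT_comp mg0 msqrt.
by apply: (measurableT_comp (measurable_pospow _)); exact: measurable_funB.
Qed.

Lemma radial_density_ge1 a u : 1 <= u -> radial_density a u = 0.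
Proof. by move=> u1; rewrite /radial_density /pospow subr_gt0 ltNge u1 mulr0.
  Qed.

(** The squared radii at which [f0] cannot be exchanged for [g0]. *)
Let bad : set R := `]-oo, 0]%classic `|` (`[1, +oo[%classic `|`
  [set u | 0 < u /\ N (Num.sqrt u)]).

Let mbad3 : measurable [set u : R | 0 < u /\ N (Num.sqrt u)].
Proof.
rewrite (_ : [set u : R | _] = `]0, +oo[%classic `&` (setT `&` Num.sqrt @^-1`
  N)).
  by apply: measurableI => //; exact: msqrt.
by rewrite setTI; apply/seteqP; split => u /=; rewrite in_itv /= andbT.
Qed.

Let mbad : measurable bad.
Proof. by apply: measurableU => //; exact: measurableU. Qed.

Section slice.
Variables (k : nat) (e : k.-tuple (measurableTypeR R)) (v : R).
Hypotheses (k2 : (1 < k)%N) (e1 : sqnorm e = 1) (v0 : 0 < v) (v1 : v < 1).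
Local Notation S := (@unit_sphere R k).
Local Notation u := (fun t => 1 - (1 - v) / 2 * (1 - tdot e t)).

Let mu_ : measurable_fun setT u.
Proof.
apply: measurable_funB => //; apply: measurable_funM => //.
by apply: measurable_funB => //; exact: measurable_tdot.
Qed.

Let Z := S `&` u @^-1` bad.

Let mZ : measurable Z.
Proof.
apply: measurableI; first exact: measurable_unit_sphere.
by rewrite -[X in measurable X]setTI; exact: mu_.
Qed.

(** The image density [cap_kernel k v] vanishes on the two half-lines of [bad], since [0 < v], and
    the remaining part of [bad] is Lebesgue null. *)
Let Z0 : @sphere_measure R k Z = 0%E.
Proof.
have mI : measurable_fun setT (fun u : R => (\1_bad u : R)%:E).
  by apply/measurable_EFinP; exact: measurable_indic.
have I0 x : (0 <= (\1_bad x : R)%:E)%E by rewrite lee_fin.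
have mZu : measurable (u @^-1` bad).
  by rewrite -[X in measurable X]setTI; exact: mu_.
have <- : (\int[@sphere_measure R k]_(t in S) (\1_bad (u t) : R)%:E)%E =
    @sphere_measure R k Z.
  transitivity (\int[@sphere_measure R k]_(t in S) (\1_(u @^-1` bad) t :
    R)%:E)%E.
    by apply: eq_integral => t _.
  by rewrite integral_indic //; [rewrite setIC | exact: measurable_unit_sphere].
rewrite (ge0_integral_sphere_cap k2 e1 v1 mI I0).
rewrite (ae_eq_integral (cst 0%E)) ?integral0 //.
  apply: emeasurable_funM => //; apply/measurable_EFinP.
  exact: measurable_cap_kernel.
exists [set u | 0 < u /\ N (Num.sqrt u)]; split => //.
  exact: negligible_preimage_sqrt.
move=> w /= /not_implyP[_ h]; apply: contrapT => Nw; apply: h.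
rewrite indicE; have [/set_mem|_] := boolP (w \in bad); last by rewrite mul0e.
rewrite /bad /= !in_itv /= andbT mul1e => -[w0|[w1|//]]; congr EFin.
  have wv : (0 < w - v) = false by rewrite subr_gt0 ltNge (le_trans w0 (ltW
    v0)).
  by rewrite /cap_kernel /rlker {2}/pospow wv !mulr0.
by rewrite /cap_kernel /pospow subr_gt0 ltNge w1 /= mul0r mulr0.
Qed.

Lemma integral_sphere_slice (h : k.-tuple (measurableTypeR R) -> R) :
  (forall t, S t -> 0 < u t < 1 -> h t = f0 (Num.sqrt (u t))) ->
  (\int[@sphere_measure R k]_(t in S) (h t)%:E =
   (2 * Num.sqrt pi ^+ k.-1 * ((1 - v) / 2) ^- (k - 2))%:E *
   efracint ((k%:R - 1) / 2) (radial_density ((k%:R - 1) / 2)) v)%E.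
Proof.
move=> hE.
rewrite (@eq_integral_offnull _ _ _ _ Z mZ Z0 S _
  (fun t => (g0 (Num.sqrt (u t)))%:E)); last first.
  move=> t St Zt; congr EFin.
  have /not_orP[/negP u0 /not_orP[/negP u1 Nu]] : ~ bad (u t) by move=> b;
    apply: Zt.
  move: u0 u1; rewrite !in_itv /= andbT -!ltNge => u0 u1.
  rewrite hE ?u0 // g0E //.
    by rewrite sqrtr_gt0 u0 -[X in _ < X]sqrtr1 ltr_sqrt.
  by move=> Ns; apply: Nu.
rewrite (integral_sphere_cap k2 e1 v1 (measurableT_comp mg0 msqrt)).
have l0 : 0 < (1 - v) / 2 by rewrite divr_gt0 // subr_gt0.
rewrite /efracint -integralZl_gt0 //.
- apply: eq_integral => w _; rewrite -EFinM; congr EFin.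
  by rewrite /cap_kernel /radial_density /=; ring.
- apply/measurable_EFinP/measurable_funM; first exact:
    measurable_radial_density.
  apply: (measurableT_comp (@measurable_rlker R _)); exact: measurable_funB.
- by rewrite !mulr_gt0 ?invr_gt0 ?exprn_gt0 ?sqrtr_gt0 ?pi_gt0.
Qed.

End slice.

End Qplus_as_fractional_integral.

Section Qplus_radial.
Context {R : realType}.
Local Notation mu := (@lebesgue_measure R).

Lemma fineZl (c : R) (x : \bar R) : 0 < c -> fine (c%:E * x)%E = c * fine x.
Proof.
move=> c0; case: x => [r||] //=; first by rewrite gt0_muley ?lte_fin ?mulr0.
by rewrite gt0_muleNy ?lte_fin ?mulr0.
Qed.

Lemma sphere_areaE (k : nat) :
  sphere_area k = 2 * Num.sqrt pi ^+ k / Gamma (k%:R / 2) :> R.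
Proof.
rewrite /sphere_area; congr (_ * _ / _).
by rewrite mulrC powRrM powR12_sqrt ?pi_ge0 // powR_mulrn ?sqrtr_ge0.
Qed.

Lemma Qplus_fracint (n k : nat) (f : 'rV[R]_n -> R) (f0 g0 : R -> R) (N : set R)
    x (xi : {vspace 'rV[R]_n}) :
  measurable N -> mu N = 0%E -> measurable_fun setT g0 ->
  (forall s, 0 < s < 1 -> ~ N s -> f0 s = g0 s) ->
  (1 < k)%N -> radial_on_ball f f0 -> 0 < enorm x < 1 ->
  grass_through k x xi -> 0 < `|2 * enorm x - 1| ->
  Num.sqrt pi / Gamma (k%:R / 2) *
    ((1 - `|2 * enorm x - 1| ^+ 2) / 2) ^+ (k - 2) * Qplus f x xi =
  fracint ((k%:R - 1) / 2) (radial_density g0 ((k%:R - 1) / 2))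
    (`|2 * enorm x - 1| ^+ 2).
Proof.
move=> mN N0 mg0 g0E k1 fr x01 [dimk xin] t0.
move: k1; rewrite -{}dimk => k1.
have [e e1 eE] := enorm_cap xin x01.
set v := `|2 * enorm x - 1| ^+ 2 in eE *.
have v0 : 0 < v by rewrite exprn_gt0.
have v1 : v < 1.
  rewrite expr_lt1 // ltr_norml; case/andP: x01 => x0 x1; apply/andP; split;
    lra.
have l0 : 0 < (1 - v) / 2 by rewrite divr_gt0 // subr_gt0.
have sp : 0 < Num.sqrt pi :> R by rewrite sqrtr_gt0 pi_gt0.
rewrite /Qplus /sphere_integral /Rintegral.
rewrite (integral_sphere_slice mN N0 mg0 g0E k1 e1 v0 v1); last first.
  move=> c Sc uc.
  have c1 : sqnorm c = 1.
    by rewrite -[LHS]sqr_sqrtr ?sqnorm_ge0 // -tnormE Sc expr1n.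
  rewrite -(eE c c1) fr // (eE c c1); case/andP: uc => u0 u1.
  by rewrite sqrtr_gt0 u0 -[ltRHS]sqrtr1 ltr_sqrt.
rewrite fineZl; last by rewrite !mulr_gt0 ?invr_gt0 ?exprn_gt0.
rewrite /fracint sphere_areaE.
have d0 : (\dim xi = (\dim xi).-1.+1)%N by rewrite prednK // ltnW.
have G0 : 0 < Gamma ((\dim xi)%:R / 2) :> R.
  by rewrite Gamma_gt0 // divr_gt0 // ltr0n ltnW.
(* The area carries [sqrt pi ^ k] and the slice [sqrt pi ^ (k - 1)]; the quotient [sqrt pi], the
   Gamma factor and the power of [(1 - v) / 2] are what the normalisation of [H] cancels. *)
rewrite [in X in 2 * X / _]d0 exprS.
move: (fine _) G0 => J; move: (Gamma _) => G G0.
have s1 : Num.sqrt pi ^+ (\dim xi).-1 != 0 :> R by rewrite expf_neq0 // gt_eqF.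
have s2 : ((1 - v) / 2) ^+ (\dim xi - 2) != 0 :> R by rewrite expf_neq0 //
  gt_eqF.
move: (_ ^+ (\dim xi).-1) s1 => A A0.
move: (_ ^+ (\dim xi - 2)) s2 => B B0.
by field; rewrite A0 B0 !gt_eqF.
Qed.

Lemma integrable_radial_density (g0 : R -> R) a :
  measurable_fun setT g0 ->
  (forall e, 0 < e < 1 -> mu.-integrable `]e, 1[
    (fun s => (g0 s * (1 - s ^+ 2) `^ (a - 1) * s)%:E)) ->
  forall e, 0 < e < 1 -> mu.-integrable `]e, 1[ (EFin \o radial_density g0 a).
Proof.
move=> mg0 ig0 e /andP[e0 e1].
pose g s := g0 s * pospow (a - 1) (1 - s ^+ 2).
have mg : measurable_fun setT g.
  apply: measurable_funM => //; apply: (measurableT_comp (measurable_pospow _)).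
  by apply: measurable_funB => //; exact: exprn_measurable.
have se : 0 < Num.sqrt e < 1.
  by rewrite sqrtr_gt0 e0 -[X in _ < X]sqrtr1 ltr_sqrt.
have e01 : 0 < e < 1 by rewrite e0.
have : mu.-integrable `]e, 1[ (fun u => (g (Num.sqrt u))%:E).
  apply: integrable_sqrt_subst => //; apply: eq_integrable (ig0 _ se) => //.
  move=> s; rewrite inE /= in_itv /= => /andP[s0 s1].
  rewrite /g /pospow subr_gt0 expr_lt1 ?s1 //.
  by rewrite (le_trans (sqrtr_ge0 e)) // ltW.
apply: eq_integrable => // u; rewrite inE /= in_itv /= => /andP[eu u1].
by rewrite /g /radial_density sqr_sqrtr // ltW // (lt_trans e0).
Qed.

End Qplus_radial.

Theorem theorem3p6 (R : realType) (n k : nat) (f : 'rV[R]_n -> R)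
    (f0 : R -> R) (hkn : (2 <= k <= n)%N) (hf : radial_on_ball f f0)
    (hf0 : forall e : R, 0 < e < 1 ->
      (@completed_lebesgue_measure R).-integrable `]e, 1[
        (fun s : R => (f0 s * (1 - s ^+ 2) `^ ((k%:R - 3) / 2) * s)%:E)) :
  (exists Phi : R -> R, Qplus_profile k f Phi) /\
  forall Phi : R -> R, Qplus_profile k f Phi ->
    {ae @lebesgue_measure R, forall s : R, 0 < s < 1 ->
      RLderivable 1 ((k%:R - 1) / 2) (Hplus k Phi) (s ^+ 2) /\
      f0 s = (1 - s ^+ 2) `^ ((3 - k%:R) / 2) *
             RLderiv 1 ((k%:R - 1) / 2) (Hplus k Phi) (s ^+ 2)}.
Proof.
have /andP[k2 kn] := hkn.
pose a : R := (k%:R - 1) / 2.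
have a0 : 0 < a by rewrite divr_gt0 // subr_gt0 ltr1n.
have aE : (k%:R - 3) / 2 = a - 1 by rewrite /a; field.
have [N [g0 [[mN N0 mg0 g00 g0E] ig0]]] := borel_representative hf0.
rewrite aE in ig0.
pose F := radial_density g0 a.
have QF x xi := @Qplus_fracint R n k f f0 g0 N x xi mN N0 mg0 g0E k2 hf.
split.
  (* The witness solves the definition of [Hplus] for [Phi] at [v = t^2]; its denominator is
     positive. *)
  exists (fun t => fracint a F (t ^+ 2) /
    (Num.sqrt pi / Gamma (k%:R / 2) * ((1 - t ^+ 2) / 2) ^+ (k - 2))).
  move=> x xi x01 xin t0; rewrite -(QF x xi) // mulrC mulKf //.
  have sp : 0 < Num.sqrt pi :> R by rewrite sqrtr_gt0 pi_gt0.
  have G0 : 0 < Gamma (k%:R / 2) :> R.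
    by rewrite Gamma_gt0 // divr_gt0 // ltr0n ltnW.
  have t1 : `|2 * enorm x - 1| ^+ 2 < 1.
    rewrite expr_lt1 // ltr_norml; case/andP: x01 => x0 x1.
    by apply/andP; split; lra.
  by rewrite gt_eqF // mulr_gt0 ?divr_gt0 ?exprn_gt0 ?divr_gt0 ?subr_gt0.
move=> Phi PhiE.
have HF y : 0 < y < 1 -> Hplus k Phi y = fracint a F y.
  move=> /andP[y0 y1].
  have sy : 0 < Num.sqrt y < 1.
    by rewrite sqrtr_gt0 y0 -[ltRHS]sqrtr1 ltr_sqrt.
  have k0n : (0 < k <= n)%N by rewrite (ltnW k2).
  have [x [xi [x01 xin tE]]] := exists_profile_point k0n sy.
  have t0 : 0 < `|2 * enorm x - 1| by rewrite tE; case/andP: sy.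
  have := QF x xi x01 xin t0.
  by rewrite (PhiE x xi x01 xin t0) tE (sqr_sqrtr (ltW y0)).
have iF := integrable_radial_density mg0 ig0.
have [A [mA A0 PA]] := ae_RLderiv_fracint (measurable_radial_density mg0 a)
  (@radial_density_ge1 R g0 a) iF a0 HF.
(* Differentiation fails on a null set of [v = s^2], which is pulled back to [s]; [N] is added
   because [F] recovers [g0] and not [f0]. *)
exists ([set s | A (s ^+ 2)] `|` N); split.
- apply: measurableU => //.
  have msqr : measurable_fun setT (fun x : R => x ^+ 2) by exact:
    exprn_measurable.
  by rewrite -[X in measurable X]setTI; exact: msqr.
- have mA2 : measurable [set s : R | A (s ^+ 2)].
    have msqr : measurable_fun setT (fun x : R => x ^+ 2) by exact:
      exprn_measurable.
    by rewrite -[X in measurable X]setTI; exact: msqr.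
  apply: measure_negligible; first exact: measurableU.
  apply: negligibleU; apply/negligibleP => //.
  exact: negligible_preimage_sqr.
move=> s /= /not_implyP[s01 nP]; apply: contrapT => /not_orP[As Ns]; apply: nP.
have [s0 s1] := andP s01.
have s2 : 0 < s ^+ 2 < 1 by rewrite exprn_gt0 //= expr_lt1 // ltW.
have [dH HE] : RLderivable 1 a (Hplus k Phi) (s ^+ 2) /\
    RLderiv 1 a (Hplus k Phi) (s ^+ 2) = F (s ^+ 2).
  by apply: contrapT => nH; apply: As; apply: PA => /= /(_ s2).
split; first exact: dH.
have w0 : 0 < 1 - s ^+ 2 by rewrite subr_gt0; case/andP: s2.
rewrite HE /F /radial_density sqrtr_sqr ger0_norm ?(ltW s0) // /pospow w0.
rewrite g0E // mulrCA -powRD ?(gt_eqF w0) ?implybT //.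
have -> : (3 - k%:R) / 2 + (a - 1) = 0 :> R by rewrite /a; field.
by rewrite powRr0 mulr1.
Qed.
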